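(* Let $p$ be a prime, $m$ a positive integer and $r$ an integer with $r^p\equiv 1 \pmod m$ and $\gcd(p(r-1),m)=1$, and let $G=\langle x,y \mid x^p=y^m=1,\ x^{-1}yx=y^r\rangle\cong C_p\ltimes C_m$ (a group of order $pm$), where $p$ is the smallest prime divisor of $|G|$. Let $S$ be a sequence over $G$ of length $|S|=m+p-2$. Then the following are equivalent: (a) $S$ is product-one free. (b) $S$ has one of the following forms: (i) if $G\not\cong C_2\ltimes C_3$, then $S=(x^ay^{b_1})\cdot\ldots\cdot(x^ay^{b_{p-1}})\cdot (y^c)^{[m-1]}$ for some $a\in[1,p-1]$, $b_i\in[0,m-1]$ ($i\in[1,p-1]$), and $c\in[1,m-1]$ with $\gcd(c,m)=1$; (ii) if $G\cong C_2\ltimes C_3$, then $S=x\cdot xy\cdot xy^2$, or $S=xy^b\cdot (y^c)^{[2]}$ for some $b\in[0,2]$ and $c\in[1,2]$.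
   Context: For real $a\le b$, $[a,b]=\{z\in\mathbb Z: a\le z\le b\}$. A sequence over a group $G$ is a finite unordered sequence of elements of $G$ with repetitions allowed (an element of the free abelian monoid on $G$), written $S=g_1\cdot g_2\cdot\ldots\cdot g_\ell$ with length $|S|=\ell$; $g^{[k]}$ denotes the sequence consisting of $k$ copies of $g$, and $\cdot$ denotes concatenation of sequences. $T\mid S$ means $T$ is a subsequence of $S$. For $S=g_1\cdot\ldots\cdot g_\ell$, $\pi(S)=\{g_{\tau(1)}\cdots g_{\tau(\ell)}:\tau \text{ a permutation of }[1,\ell]\}$, $\Pi_n(S)=\bigcup_{T\mid S,\,|T|=n}\pi(T)$, and $\Pi(S)=\bigcup_{1\le n\le \ell}\Pi_n(S)$. $S$ is product-one free if $1\notin\Pi(S)$.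
   Formalization: The formal theorem assumes m ≥ 2 instead of m positive: for m = 1 the equivalence fails, since G = C_p and S = x^{[p-1]} is product-one free while the range c ∈ [1, m-1] in (i) is empty. *)

(* Defs.v *)
From mathcomp Require Import all_boot all_order all_algebra all_fingroup all_solvable.

Set Implicit Arguments.
Unset Strict Implicit.
Unset Printing Implicit Defensive.

Import GRing.Theory.

Local Open Scope group_scope.

(* A sequence over a group is a [seq] considered up to [perm_eq]. *)
Section Sequences.

Variable gT : finGroupType.
Implicit Types S T U : seq gT.

(* Divisibility in the free abelian monoid. *)
Definition subsequence T S : Prop := exists U, perm_eq (T ++ U) S.

Definition pi_products S (g : gT) : Prop :=
  exists2 T, perm_eq T S & g = \prod_(h <- T) h.

Definition Pi_n (n : nat) S (g : gT) : Prop :=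
  exists T, [/\ subsequence T S, size T = n & pi_products T g].

Definition Pi_all S (g : gT) : Prop :=
  exists2 n, (1 <= n <= size S)%N & Pi_n n S g.

Definition product_one_free S : Prop := ~ Pi_all S 1.

End Sequences.

(* [Negz n] is the integer - n.+1. *)
Definition expgz (gT : finGroupType) (g : gT) (k : int) : gT :=
  match k with
  | Posz n => g ^+ n
  | Negz n => g ^- n.+1
  end.

(* G is isomorphic to < x, y | x^p = y^m = 1, x^-1 y x = y^r >. The case
   analysis on r is needed because the syntax of presentations only accepts
   exponents in nat. *)
Definition isog_CpCm (gT : finGroupType) (G : {group gT}) (p m : nat) (r : int)
    : Prop :=
  match r with
  | Posz n => G \isog Grp (x : y : x ^+ p, y ^+ m, y ^ x = y ^+ n)
  | Negz n => G \isog Grp (x : y : x ^+ p, y ^+ m, y ^ x = y ^- n.+1)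
  end.

(* G = < x, y | x^p = y^m = 1, x^-1 y x = y^r >, with named generators. As G
   is finite, any surjection from the presented group onto G is injective, so
   the relations between these x and y all follow from the three stated. *)
Definition presented_CpCm (gT : finGroupType) (G : {group gT}) (p m : nat)
    (r : int) (x y : gT) : Prop :=
  [/\ isog_CpCm G p m r,
      <<[set x; y]>> = G,
      x ^+ p = 1,
      y ^+ m = 1
    & y ^ x = expgz y r].

(* Main.v *)
Require Import Defs.
From mathcomp Require Import all_boot all_order all_algebra all_fingroup all_solvable.
From mathcomp Require Import zify.
From Stdlib Require Import Classical.

(* Let N = <y>, so that G / N has order p and, since gcd(r - 1, m) = 1, elements
   outside N centralize no nontrivial element of N. Scherk's theorem, that
   |AB| >= |A| + |B| - 1 when 1 is in A and B and has only the trivial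
   factorization in AB, makes the number of products in N additive over disjoint
   subsequences of a product-one free sequence. A minimal subsequence T with
   product in N has |T| such products, because its rotations conjugate the
   product by elements of distinct cosets of N. Hence S splits into such blocks,
   of total length m - 1, and a remainder of p - 1 elements in one coset aN.

   If all blocks lie in N, the inverse zero-sum theorem for C_m gives form (i).
   Otherwise some block consists of p elements of aN and, with the remainder,
   gives 2p - 1 elements of aN having at most p products in N. For odd p they
   contain p - 1 pairs of distinct elements, and choosing one element of each
   pair already gives p + 1 products. For p = 2 the bound forces the three
   involutions to generate a dihedral group of order 6, which leaves no room for
   another block, so m = 3. *)

Set Implicit Arguments.
Unset Strict Implicit.
Unset Printing Implicit Defensive.
Import GRing.Theory.
Local Open Scope group_scope.

(* lia distinguishes sizes of sequences whose types are merely convertible;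
   simpl identifies them. *)
Ltac size_lia :=
  repeat match goal with
  | H : is_true (leq _ _) |- _ => revert H
  | H : is_true (andb (leq _ _) (leq _ _)) |- _ => revert H
  | H : @eq nat _ _ |- _ => revert H
  | H : is_true (negb (@eq_op Datatypes_nat__canonical__eqtype_Equality _ _)) |- _
    => revert H
  end; clear; simpl; intros; lia.

(** * Products of subsequences and Scherk's theorem *)

Section Reach.
Variable gT : finGroupType.
Implicit Types (T U V W : seq gT) (A B : {set gT}) (N : {group gT}).

(** The list [T] is ordered, while [perm_eq] forgets the order of [T ++ W], so the choice of a
    subsequence and of an arrangement of it become a single choice of [T]. *)
Definition reach U g :=
  exists T W, [/\ perm_eq (T ++ W) U, T != [::] & \prod_(h <- T) h = g].

Lemma Pi_allE U g : Pi_all U g <-> reach U g.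
Proof.
split=> [[n n_bd [T [[W TW] sT [T' T'T ->]]]]|[T [W [TW T0 <-]]]].
  exists T', W; split=> //.
    by rewrite (perm_trans _ TW) // perm_cat2r.
  rewrite -size_eq0 (perm_size T'T) sT; lia.
exists (size T).
  rewrite -(perm_size TW) size_cat; move: T0; rewrite -size_eq0; size_lia.
by exists T; split=> //; [exists W | exists T].
Qed.

Definition one_free U := ~ reach U 1.

Lemma reach_perm U V g : perm_eq U V -> reach U g -> reach V g.
Proof.
by move=> UV [T [W [TW T0 <-]]]; exists T, W; split=> //; apply: perm_trans UV.
Qed.

Lemma reach_catl U V g : reach U g -> reach (U ++ V) g.
Proof.
move=> [T [W [TW T0 <-]]]; exists T, (W ++ V); split=> //.
by rewrite catA perm_cat2r.
Qed.

Lemma reach_catr U V g : reach V g -> reach (U ++ V) g.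
Proof. by move=> /(reach_catl U); apply: reach_perm; rewrite perm_catC. Qed.

Lemma reach_mul U V g h : reach U g -> reach V h -> reach (U ++ V) (g * h).
Proof.
move=> [T [W [TW T0 <-]]] [T' [W' [TW' T0' <-]]].
exists (T ++ T'), (W ++ W'); split; last by rewrite big_cat.
  rewrite perm_catACA; exact: perm_cat.
by move: T0; rewrite -!size_eq0 size_cat; size_lia.
Qed.

Lemma reach_prod U : U != [::] -> reach U (\prod_(h <- U) h).
Proof. by move=> U0; exists U, [::]; rewrite cats0. Qed.

Lemma reach1 g : reach [:: g] g.
Proof. by exists [:: g], [::]; rewrite big_seq1. Qed.

Lemma one_free_perm U V : perm_eq U V -> one_free U -> one_free V.
Proof. by rewrite perm_sym => VU fU rV; apply: fU; apply: reach_perm rV. Qed.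

Lemma one_free_catl U V : one_free (U ++ V) -> one_free U.
Proof. by move=> fUV rU; apply/fUV/reach_catl. Qed.

Lemma one_free_catr U V : one_free (U ++ V) -> one_free V.
Proof. by move=> fUV rU; apply/fUV/reach_catr. Qed.

(** Induction on [#|B|] by the Dyson transform: [A] grows to its union with [a *: B] and [B] shrinks
    to its intersection with [a^-1 *: A], which keeps the sum of the cardinals and does not enlarge
    the product set. *)
Lemma scherk N A B :
    abelian N -> A \subset N -> B \subset N -> 1 \in A -> 1 \in B ->
    (forall a b, a \in A -> b \in B -> a * b = 1 -> a = 1) ->
  (#|A| + #|B| <= #|(A * B)%g|.+1)%N.
Proof.
move=> abN; have [n] := ubnP #|B|; elim: n => // n IH in A B *.
move=> ltBn sAN sBN A1 B1 trivAB.
have [B_1|/subsetPn[b Bb]] := boolP (B \subset [1]).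
  have -> : B = 1 by apply/eqP; rewrite eqEsubset B_1 sub1set.
  by rewrite mulg1 cards1 addn1.
rewrite inE => b_neq1.
(* If [A :* b = A], then [b^-1] lies in [A] and [b^-1 * b] is a nontrivial factorization of [1].
   This choice of [a] removes [b] from [B'], so the induction descends. *)
have [a Aa Aab] : exists2 a, a \in A & a * b \notin A.
  have [sAbA|/subsetPn[_ /rcosetP[a Aa ->]]] := boolP (A :* b \subset A);
    last by exists a.
  have /eqP AbA : A :* b == A by rewrite eqEcard sAbA card_rcoset leqnn.
  have Ab : b^-1 \in A by have := A1; rewrite -{1}AbA mem_rcoset mul1g.
  case/eqP: b_neq1; apply: invg_inj; rewrite invg1.
  by apply: (trivAB _ b) => //; rewrite mulVg.
have comN g h : g \in N -> h \in N -> g * h = h * g.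
  by move=> Ng Nh; apply: (centsP abN).
have NA := subsetP sAN; have NB := subsetP sBN.
pose A' := A :|: a *: B; pose B' := B :&: a^-1 *: A.
have inB' c : (c \in B') = (c \in B) && (a * c \in A).
  by rewrite inE mem_lcoset invgK.
have cardAB : (#|A'| + #|B'| = #|A| + #|B|)%N.
  have -> : #|B'| = #|A :&: a *: B|.
    rewrite -(card_lcoset B' a); congr #|pred_of_set _|; apply/setP=> c.
    by rewrite mem_lcoset inB' inE mem_lcoset mulKVg andbC.
  by rewrite -(card_lcoset B a) cardsUI.
have sAB : A' * B' \subset A * B.
  apply/subsetP=> _ /mulsgP[a' b' A'a' + ->]; rewrite inB' => /andP[Bb' Aab'].
  move: A'a'; rewrite inE => /orP[Aa'|/lcosetP[c Bc ->]]; first exact: mem_mulg.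
  by rewrite -mulgA (comN c) ?NB // mulgA mem_mulg.
rewrite -cardAB; apply: (@leq_trans #|(A' * B')%g|.+1); last first.
  by rewrite ltnS subset_leq_card.
apply: IH.
- move: ltBn; rewrite ltnS; apply: leq_trans; apply: proper_card.
  apply/properP; split.
    exact: subsetIl.
  by exists b; rewrite ?inB' ?Bb.
- rewrite subUset sAN; apply/subsetP=> _ /lcosetP[c Bc ->].
  by apply: groupM; [exact: NA | exact: NB].
- by rewrite subIset ?sBN.
- by rewrite inE A1.
- by rewrite inB' B1 mulg1.
move=> a' b'; rewrite inB' inE => + /andP[Bb' Aab'].
(* For [a' = a * c], commutativity regroups the equation as [a * b' * c = 1] with [a * b'] in [A];
   hence [a * b' = 1], and then [c = 1] and [a = 1]. *)
case/orP=> [Aa'|/lcosetP[c Bc ->]]; first exact: trivAB.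
rewrite -mulgA (comN c) ?NB // mulgA => abc1.
have ab1 := trivAB _ _ Aab' Bc abc1.
move: abc1; rewrite ab1 mul1g => ->; rewrite mulg1.
exact: trivAB ab1.
Qed.

(** [reach] is a proposition, not a finite set, so the number of products in [N] is bounded below
    through a witness set [A]. *)
Definition rich N U k :=
  exists A, [/\ A \subset N, (k <= #|A|)%N & forall g, g \in A -> reach U g].

(** Scherk's theorem applies after adjoining [1] to both sets: [U ++ V] has no product-one
    subsequence, so [1] factors only trivially. Discarding [1] from the product set leaves [k + l]
    elements. *)
Lemma rich_cat N U V k l : abelian N -> one_free (U ++ V) ->
  rich N U k -> rich N V l -> rich N (U ++ V) (k + l).
Proof.
move=> abN fUV [A [sAN kA rA]] [B [sBN lB rB]].
have A1 : 1 \notin A by apply/negP=> /rA /(reach_catl V).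
have B1 : 1 \notin B by apply/negP=> /rB /(reach_catr U).
set A' := 1 |: A; set B' := 1 |: B.
have scAB : (#|A'| + #|B'| <= #|(A' * B')%g|.+1)%N.
  apply: (@scherk N); rewrite /A' /B'; rewrite ?subUset ?sub1G ?setU11 //.
  move=> a b.
  rewrite !inE => /orP[/eqP->|Aa] // /orP[/eqP->|Bb]; first by rewrite mulg1.
  by move=> ab1; case: fUV; rewrite -ab1; apply: reach_mul; auto.
exists ((A' * B') :\ 1); split.
- apply/subsetP=> g; rewrite inE => /andP[_ /mulsgP[a b]].
  move=> /setU1P[->|/(subsetP sAN) Na] /setU1P[->|/(subsetP sBN) Nb] ->;
  by rewrite ?groupM.
- apply: leq_trans (leq_add kA lB) _; move: scAB.
  rewrite (cardsD1 1 (A' * B')) -{1}[1]mulg1 mem_mulg ?setU11 //.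
  by rewrite !cardsU1 A1 B1 !add1n addSn addnS !ltnS.
move=> g /setD1P[g1 /mulsgP[a b /setU1P Aa /setU1P Bb def_g]].
rewrite {}def_g in g1 *.
case: Aa Bb => [?|/rA ra] [?|/rB rb]; subst.
- by rewrite mulg1 eqxx in g1.
- by rewrite mul1g; apply: reach_catr.
- by rewrite mulg1; apply: reach_catl.
exact: reach_mul.
Qed.

Lemma rich_lt N U k : one_free U -> rich N U k -> (k < #|N|)%N.
Proof.
move=> fU [A [sAN kA rA]]; apply: (leq_ltn_trans kA); apply: proper_card.
by apply/properP; split=> //; exists 1 => //; apply/negP=> /rA.
Qed.

Lemma rich_seq N U : abelian N -> one_free U -> {subset U <= N} ->
  rich N U (size U).
Proof.
move=> abN; elim: U => [|g U IH] fU sUN.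
  by exists set0; split; rewrite ?sub0set ?cards0 // => g; rewrite inE.
rewrite -cat1s size_cat; apply: rich_cat => //.
  exists [set g]; split; rewrite ?sub1set ?cards1 ?sUN ?mem_head //.
  by move=> h /set1P->; apply: reach1.
apply: IH => [|h Uh]; first exact: (one_free_catr (U := [:: g])).
by apply: sUN; rewrite inE Uh orbT.
Qed.

Lemma one_free_abelian_size N U : abelian N -> one_free U -> {subset U <= N} ->
  (size U < #|N|)%N.
Proof. by move=> abN fU sUN; exact: rich_lt fU (rich_seq abN fU sUN). Qed.

(* Two distinct elements g, h would contribute three products g, h, gh. *)
Lemma one_free_abelian_constant N U :
    abelian N -> one_free U -> {subset U <= N} ->
  size U = #|N|.-1 -> exists z, U = nseq (size U) z.
Proof.
case: U => [|g U] abN fU sUN sizeU; first by exists 1.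
exists g; apply/all_pred1P => /=; rewrite eqxx /=; apply/allPn => -[h Uh /= hg].
have perm_gh : perm_eq (g :: U) ([:: g; h] ++ rem h U).
  by rewrite /= perm_cons perm_to_rem.
have fgh := one_free_perm perm_gh fU.
have sN : {subset [:: g; h] ++ rem h U <= N}.
  by move=> k; rewrite -(perm_mem perm_gh); apply: sUN.
have Ng : g \in N by apply: sN; rewrite mem_head.
have Nh : h \in N by apply: sN; rewrite !inE eqxx orbT.
have [rg rh] := (reach1 g, reach1 h).
have f2 := one_free_catl fgh.
have g1 : g != 1.
  by apply/eqP=> g1; move: rg (@one_free_catl [:: g] [:: h] f2); rewrite g1.
have h1 : h != 1.
  by apply/eqP=> h1; move: rh (@one_free_catr [:: g] [:: h] f2); rewrite h1.
have rich3 : rich N [:: g; h] 3.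
  exists [set g; h; g * h]; split.
  - by rewrite !subUset !sub1set Ng Nh groupM.
  - rewrite setUC cardsU1 cards2 !inE (eq_sym g) hg negb_or.
    rewrite -{2}[g]mulg1 (inj_eq (mulgI g)) h1.
    by rewrite -{2}[h]mul1g (inj_eq (mulIg h)) g1.
  move=> k; rewrite !inE => /orP[/orP[]|] /eqP->.
  - exact: (reach_catl [:: h] rg).
  - exact: (reach_catr [:: g] rh).
  exact: (reach_mul rg rh).
have richr : rich N (rem h U) (size (rem h U)).
  apply: rich_seq => //; first exact: one_free_catr fgh.
  by move=> k kU; apply: sN; rewrite mem_cat kU orbT.
move: (rich_lt fgh (rich_cat abN fgh rich3 richr)) sizeU.
by rewrite /= size_rem //; move: Uh; case: (U) => //= *; size_lia.
Qed.

End Reach.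

(** * Lifting rearrangements and pairing distinct elements *)

Lemma perm_eq_map_lift (T1 T2 : eqType) (f : T1 -> T2) s U :
  perm_eq s (map f U) -> exists2 U', perm_eq U' U & s = map f U'.
Proof.
case: U => [|x0 U] sU.
  by exists [::] => //; apply/nilP; rewrite /nilp (perm_size sU).
set V := x0 :: U in sU *; have /(perm_iotaP (f x0))[I IV ->] := sU.
exists (map (nth x0 V) I).
  by apply/(perm_iotaP x0); exists I => //; rewrite size_map in IV.
rewrite -map_comp; apply/eq_in_map => i; rewrite (perm_mem IV) mem_iota.
by move=> /andP[_ iV]; rewrite (nth_map x0) //; rewrite size_map in iV.
Qed.

(** Each step pairs a most frequent element [x] with some other element [y]; this greedy choice
    preserves the bound on multiplicities. *)
Lemma distinct_pairs (T : finType) n (U : seq T) :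
    (n.*2 <= size U)%N -> (forall z, count_mem z U <= size U - n)%N ->
  exists ps R, [/\ size ps = n, all (fun q : T * T => q.1 != q.2) ps &
    perm_eq (flatten [seq [:: q.1; q.2] | q <- ps] ++ R) U].
Proof.
elim: n U => [|n IH] U leU cU; first by exists [::], U.
have [x0 Ux0] : exists x0, x0 \in U.
  by case: (U) leU => // x0 *; exists x0; rewrite mem_head.
have [x _ maxx] := @arg_maxnP T x0 xpredT (fun z => count_mem z U) isT.
have Ux : x \in U.
  rewrite -has_pred1 has_count (leq_trans _ (maxx x0 isT)) //.
  by rewrite -has_count has_pred1.
have /allPn[y Uy /= yx] : ~~ all (pred1 x) U.
  by rewrite all_count; apply/eqP=> cx; have := cU x; rewrite cx; size_lia.
have xyV : perm_eq (x :: y :: rem y (rem x U)) U.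
  rewrite perm_sym (perm_trans (perm_to_rem Ux)) // perm_cons perm_to_rem //.
  by move: Uy; rewrite (perm_mem (perm_to_rem Ux)) inE (negPf yx).
move: (rem y _) xyV => W xyV; have sW := perm_size xyV.
have cW z : ((x == z) + ((y == z) + count_mem z W) = count_mem z U)%N.
  by rewrite -(seq.permP xyV).
have [||ps [R [sps dps psR]]] := IH W.
- by rewrite -sW /= in leU; size_lia.
- move=> z; have := cU z; rewrite -cW -sW /=.
  case: (eqVneq x z) => [_|xz] /=; first size_lia.
  case: (eqVneq y z) => [_|yz] /=; first size_lia.
  (* Here [z] loses no copy, but by the choice of [x] at least [count_mem z W - 1] copies of [x]
     remain in [W], so twice the multiplicity of [z] is at most [size W + 1]. *)
  have := maxx z isT; rewrite -!cW eqxx (negPf xz) (negPf yz) (negPf yx) /=.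
  have : (count_mem x W + count_mem z W <= size W)%N.
    rewrite -count_predUI (@eq_count _ (predI _ _) pred0) ?count_pred0 ?addn0.
      exact: count_size.
    by move=> t /=; case: eqP => // ->; rewrite (negPf xz).
  rewrite -sW /= in leU; move: leU (count_mem x W) (count_mem z W); clear=> *.
  size_lia.
exists ((x, y) :: ps), R; split; rewrite /= ?sps ?dps ?andbT // 1?eq_sym //.
by rewrite (perm_trans _ xyV) // !perm_cons.
Qed.

(** * Growth of product sets of pairs *)

Section SetGrowth.
Variable gT : finGroupType.
Implicit Types (X : {set gT}) (ps : seq (gT * gT)).

(** Without growth, [X :* a] and [X :* b] both fill the product set, so [X] is stable under right
    multiplication by [a * b^-1] and contains a left coset of the subgroup generated by it. *)
Lemma card_mul_pair X (a b : gT) :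
  X != set0 -> (#|X| < #[a * b^-1]%g)%N -> (#|X| < #|(X * [set a; b])%g|)%N.
Proof.
case/set0Pn=> x Xx ltX; rewrite ltnNge; apply: contraL ltX => leX.
rewrite -leqNgt.
have Xab c : c \in [set a; b] -> X :* c = X * [set a; b].
  by move=> abc; apply/eqP; rewrite eqEcard card_rcoset leX mulgS ?sub1set.
have Xd : X :* (a * b^-1) = X.
  by rewrite rcosetM Xab ?set21 // -(Xab b) ?set22 // rcosetK.
have Xdi i : x * (a * b^-1) ^+ i \in X.
  elim: i => [|i IH]; first by rewrite mulg1.
  by rewrite expgSr mulgA -Xd mem_rcoset mulgK.
rewrite orderE -(card_lcoset <[a * b^-1]> x); apply: subset_leq_card.
by apply/subsetP=> _ /lcosetP[_ /cycleP[i ->] ->].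
Qed.

(** By [card_mul_pair], every pair adds at least one element until the cardinal exceeds [n]; from
    then on multiplication cannot shrink the set. *)
Lemma card_mul_pairs n k ps X : X != set0 ->
    all (fun q => n < #[q.1 * q.2^-1]) ps ->
    (k <= #|X|)%N -> (k + size ps <= n.+1)%N ->
  (k + size ps <= #|(X * \prod_(q <- ps) [set q.1; q.2])%g|)%N.
Proof.
elim: ps k X => [|q ps IH] k X X0 /=; first by rewrite big_nil mulg1 addn0.
case/andP=> lt_n ltps leX le_n; rewrite big_cons mulgA addnS -addSn.
have X1 : X * [set q.1; q.2] != set0.
  have [x Xx] := set0Pn _ X0; apply/set0Pn; exists (x * q.1).
  by rewrite mem_mulg ?set21.
apply: IH => //; last by rewrite addSn -addnS.
have [leXn|ltnX] := leqP #|X| n.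
  by apply: leq_ltn_trans leX (card_mul_pair X0 (leq_ltn_trans leXn lt_n)).
apply: leq_trans (_ : #|X| <= _)%N.
  by move: le_n ltnX; rewrite addnS; clear; lia.
by rewrite -(card_rcoset X q.1) subset_leq_card // mulgS ?sub1set ?set21.
Qed.

Lemma card_mul_two_pairs (a1 b1 a2 b2 : gT) :
    a1 != b1 -> a2 != b2 -> a1 * a2 != b1 * b2 -> a1 * b2 != b1 * a2 ->
  (4 <= #|([set a1; b1] * [set a2; b2])%g|)%N.
Proof.
move=> n1 n2 n3 n4; pose s := [:: a1 * a2; a1 * b2; b1 * a2; b1 * b2].
have us : uniq s.
  rewrite /= !inE !negb_or n3 n4 !(inj_eq (mulgI _)) !(inj_eq (mulIg _)) n1 n2.
  by [].
rewrite -[4%N]/(size s) -(card_uniqP us); apply: subset_leq_card.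
apply/subsetP=> g; rewrite !inE => /or4P[] /eqP->; 
  by rewrite mem_mulg ?set21 ?set22.
Qed.

Lemma mem_prod_pairs g ps : g \in \prod_(q <- ps) [set q.1; q.2] ->
  exists T W, [/\ perm_eq (T ++ W) (flatten [seq [:: q.1; q.2] | q <- ps]),
    size T = size ps & g = \prod_(h <- T) h].
Proof.
elim: ps g => [|q ps IH] g.
  by rewrite big_nil => /set1P->; exists [::], [::]; rewrite big_nil.
rewrite big_cons => /mulsgP[u v qu /IH[T [W [TW sT ->]]] ->].
have [w uw] : exists w, perm_eq [:: u; w] [:: q.1; q.2].
  case/set2P: qu => ->; first by exists q.2.
  by exists q.1; rewrite (perm_catC [:: q.2] [:: q.1]).
exists (u :: T), (w :: W); split; rewrite /= ?sT ?big_cons //.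
apply: (@perm_trans _ ([:: u; w] ++ (T ++ W))); last exact: (perm_cat uw TW).
by rewrite /= perm_cons -[w :: W]cat1s perm_catCA.
Qed.

End SetGrowth.

(** * Sequences over a Frobenius group with complement of prime order *)

Section Frobenius.
Variables (gT : finGroupType) (G N : {group gT}) (p : nat).
Implicit Types (S T U V W : seq gT) (Ts : seq (seq gT)).
Hypotheses (p_pr : prime p) (abN : abelian N) (nNG : N <| G).
Hypothesis oGN : #|G / N| = p.
Hypothesis regN : forall g z, g \in G -> g \notin N -> z \in N ->
  commute z g -> z = 1.

Local Notation k := (coset N).
Local Notation prod T := (\prod_(h <- T) h).

Let sNG g : g \in N -> g \in G := subsetP (normal_sub nNG) g.
Let nNg g : g \in G -> g \in 'N(N) := subsetP (normal_norm nNG) g.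

Lemma prod_in_group T : {subset T <= G} -> prod T \in G.
Proof. by move=> sTG; rewrite big_seq; apply: group_prod. Qed.

Lemma coset_prod T : {subset T <= G} -> k (prod T) = \prod_(h <- map k T) h.
Proof.
elim: T => [|g T IH] sTG; first by rewrite !big_nil morph1.
have sTG' : {subset T <= G} by move=> h Th; rewrite sTG // inE Th orbT.
have Gg : g \in G by rewrite sTG ?mem_head.
by rewrite /= !big_cons morphM ?nNg ?prod_in_group //= IH.
Qed.

Lemma coset_eq1 g : g \in G -> (k g == 1) = (g \in N).
Proof.
move=> Gg; apply/eqP/idP=> [/coset_idr|]; last exact: coset_id.
by apply; apply: nNg.
Qed.

Lemma coset_expg_eq1 g n : g \in G -> g \notin N ->
  (k g ^+ n == 1) = (p %| n)%N.
Proof.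
move=> Gg Ng; rewrite -order_dvdn; congr (_ %| _)%N.
have: #[k g] %| p by rewrite -oGN order_dvdG ?mem_quotient.
case/primeP: p_pr => _ dvp /dvp.
by rewrite order_eq1 coset_eq1 // (negPf Ng) => /eqP.
Qed.

Lemma prod_nseq (rT : finGroupType) n (g : rT) :
  \prod_(h <- nseq n g) h = g ^+ n.
Proof. by elim: n => [|n IH]; rewrite ?big_nil // big_cons IH expgS. Qed.

Lemma prod_coset_const T c :
  {subset T <= G} -> all (fun g => k g == c) T -> k (prod T) = c ^+ size T.
Proof.
move=> sTG Tc; rewrite coset_prod // (_ : map k T = nseq (size T) c).
  exact: prod_nseq.
by rewrite -(size_map k); apply/all_pred1P; rewrite all_map.
Qed.

(** * Blocks, lifting minimal zero-sum sequences over [G / N] *)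

Definition block T := [/\ T != [::], prod T \in N &
  forall T1 T2, perm_eq (T1 ++ T2) T -> T1 != [::] -> T2 != [::] ->
    prod T1 \notin N].

Definition zero_sum_free U :=
  forall T W, perm_eq (T ++ W) U -> T != [::] -> prod T \notin N.

Lemma prod_rot i T : prod (seq.rot i T) = prod T ^ prod (take i T).
Proof.
by rewrite -{2}(cat_take_drop i T) /seq.rot !big_cat conjgE /= mulgA mulKg.
Qed.

Lemma block_rot i T : {subset T <= G} -> block T -> block (seq.rot i T).
Proof.
move=> sTG [T0 NT minT]; split.
- by rewrite -size_eq0 size_rot size_eq0.
- rewrite prod_rot memJ_norm // nNg // prod_in_group // => g /mem_take.
  exact: sTG.
by move=> T1 T2 T12; apply: minT; rewrite (perm_trans T12) ?perm_rot.
Qed.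

(* The products of the rotations of T are the conjugates of prod T by the prefix
   products, which lie in distinct cosets of N by minimality. *)
Lemma rich_block T : {subset T <= G} -> one_free T -> block T ->
  rich N T (size T).
Proof.
move=> sTG fT [T0 NT minT]; set P := prod T in NT.
have P1 : P != 1 by apply/eqP=> P1; apply: fT; rewrite -P1; apply: reach_prod.
have Gtake i : prod (take i T) \in G.
  by apply: prod_in_group => g /mem_take /sTG.
exists [set prod (seq.rot (i : nat) T) | i : 'I_(size T)]; split.
- apply/subsetP=> _ /imsetP[i _ ->].
  by rewrite prod_rot memJ_norm // nNg.
- rewrite card_imset ?card_ord // => i j.
  wlog ltij : i j / (i <= j)%N.
    by move=> H; have [/H|/ltnW/H Hji /esym/Hji] := leqP i j.
  move: ltij; rewrite leq_eqVlt => /orP[/eqP/val_inj //|ltij].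
  rewrite !prod_rot -/P => eqPij.
  set mid := take (j - i) (drop i T).
  have def_j : take j T = take i T ++ mid by rewrite -takeD subnKC // ltnW.
  have sz_mid : size mid = (j - i)%N.
    by rewrite size_takel // size_drop leq_sub2r // ltnW.
  have pmid : perm_eq (mid ++ (take i T ++ drop j T)) T.
    by rewrite -[X in perm_eq _ X](cat_take_drop j T) def_j -catA perm_catCA.
  have Nmid : prod mid \notin N.
    apply: minT pmid _ _; rewrite -size_eq0.
      by rewrite sz_mid subn_eq0 -ltnNge.
    rewrite size_cat size_drop addn_eq0 negb_and subn_eq0 -ltnNge ltn_ord.
    exact: orbT.
  case/negP: P1; rewrite -(conjg_eq1 _ (prod (take i T))); apply/eqP.
  apply: (@regN (prod mid)) => //.
  - apply: prod_in_group => g /mem_take /mem_drop; exact: sTG.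
  - by rewrite memJ_norm // nNg.
  apply/commgP/conjg_fixP; rewrite -conjgM.
  by rewrite eqPij def_j big_cat.
move=> _ /imsetP[i _ ->]; exists (seq.rot i T), [::]; rewrite cats0 perm_rot.
by rewrite -size_eq0 size_rot size_eq0.
Qed.

Lemma zero_sum_free_behead g T : block (g :: T) -> zero_sum_free T.
Proof.
move=> [_ _ minT] T1 T2 T12 T1_0; apply: (minT _ (g :: T2)) => //.
by rewrite -cat1s perm_catCA /= perm_cons.
Qed.

Lemma block_or_zero_sum_free U :
  (exists T W, block T /\ perm_eq (T ++ W) U) \/ zero_sum_free U.
Proof.
have [n] := ubnP (size U); elim: n U => // n IH U ltUn.
have [[T [W [TW T0 NT]]]|noT] := classic (exists T W,
    [/\ perm_eq (T ++ W) U, T != [::] & prod T \in N]); last first.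
  by right=> T W TW T0; apply/negP=> NT; apply: noT; exists T, W.
left; have [[T1 [T2 [T12 T1_0 T2_0 NT1]]]|minT] := classic (exists T1 T2,
    [/\ perm_eq (T1 ++ T2) T, T1 != [::], T2 != [::] & prod T1 \in N]).
  have [|[T' [W' [bT' T'W']]]|zT1] := IH T1.
  - move: ltUn T2_0; rewrite -(perm_size TW) size_cat -(perm_size T12) size_cat.
    by rewrite -size_eq0; size_lia.
  - exists T', (W' ++ (T2 ++ W)); split=> //.
    rewrite (perm_trans _ TW) // !catA.
    by rewrite perm_cat2r (perm_trans _ T12) // perm_cat2r.
  by have := zT1 T1 [::]; rewrite cats0 perm_refl NT1 => /(_ isT T1_0).
exists T, W; split=> //; split=> // T1 T2 T12 T1_0 T2_0; apply/negP=> NT1.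
by apply: minT; exists T1, T2.
Qed.

Lemma block_decomposition U : exists Ts V,
  [/\ perm_eq (flatten Ts ++ V) U, forall T, T \in Ts -> block T
    & zero_sum_free V].
Proof.
have [n] := ubnP (size U); elim: n U => // n IH U ltUn.
have [[T [W [bT TW]]]|zU] := block_or_zero_sum_free U; last by exists [::], U.
have [|Ts [V [TsV bTs zV]]] := IH W.
  move: ltUn; rewrite -(perm_size TW) size_cat.
  by case: bT => + _ _; rewrite -size_eq0; size_lia.
exists (T :: Ts), V; split=> //.
  by rewrite /= -catA (perm_trans _ TW) // perm_cat2l.
by move=> T'; rewrite inE => /orP[/eqP->|/bTs].
Qed.

Lemma rich_flatten Ts : {subset flatten Ts <= G} -> one_free (flatten Ts) ->
  (forall T, T \in Ts -> block T) -> rich N (flatten Ts) (size (flatten Ts)).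
Proof.
elim: Ts => [|T Ts IH] sTG fTs bTs; first exact: rich_seq.
rewrite /= in sTG fTs *; rewrite size_cat; apply: rich_cat => //.
  apply: rich_block; first by move=> g Tg; rewrite sTG // mem_cat Tg.
    exact: one_free_catl fTs.
  by apply: bTs; rewrite mem_head.
apply: IH; first by move=> g Tg; rewrite sTG // mem_cat Tg orbT.
  exact: one_free_catr fTs.
by move=> T' Ts'; apply: bTs; rewrite inE Ts' orbT.
Qed.

(** * Zero-sum free sequences over the quotient of order [p] *)

Lemma zero_sum_free_quotient V : {subset V <= G} -> zero_sum_free V ->
  one_free (map k V).
Proof.
move=> sVG zV [T' [W' [/perm_eq_map_lift[V' V'V def_V'] T'0 prodT']]].
set n := size T'.
have def_T' : T' = map k (take n V').
  by rewrite map_take -def_V' take_size_cat.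
have sTG : {subset take n V' <= G}.
  by move=> g /mem_take; rewrite (perm_mem V'V); apply: sVG.
have := zV (take n V') (drop n V'); rewrite cat_take_drop => /(_ V'V).
rewrite -coset_eq1 ?prod_in_group // coset_prod // -def_T' prodT' eqxx.
by case: eqP => [T0 _|_ /(_ isT)] //; rewrite def_T' T0 in T'0.
Qed.

Let abGN : abelian (G / N).
Proof. by apply: cyclic_abelian; apply: prime_cyclic; rewrite oGN. Qed.

Let sub_quo V : {subset V <= G} -> {subset map k V <= G / N}.
Proof. by move=> sVG _ /mapP[g Vg ->]; rewrite mem_quotient ?sVG. Qed.

(** The Davenport constant of the cyclic group [G / N] is [p]. *)
Lemma zero_sum_free_size V : {subset V <= G} -> zero_sum_free V ->
  (size V < p)%N.
Proof.
move=> sVG zV; rewrite -(size_map k) -oGN.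
apply: one_free_abelian_size => //; last exact: sub_quo.
exact: zero_sum_free_quotient.
Qed.

Lemma zero_sum_free_constant V : {subset V <= G} -> zero_sum_free V ->
  size V = p.-1 -> exists c, all (fun g => k g == c) V.
Proof.
move=> sVG zV szV.
have [||||c Vc] := @one_free_abelian_constant _ (G / N)%G (map k V).
- exact: abGN.
- exact: zero_sum_free_quotient.
- exact: sub_quo.
- by rewrite size_map szV oGN.
by exists c; move/all_pred1P: Vc; rewrite all_map.
Qed.

Lemma quotient_expg_p c : c \in G / N -> c ^+ p = 1.
Proof. by move=> Gc; apply/eqP; rewrite -order_dvdn -oGN order_dvdG. Qed.

Lemma mem_prod_const T c : {subset T <= G} -> all (fun g => k g == c) T ->
  c != 1 -> (prod T \in N) = (p %| size T)%N.
Proof.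
case: T => [|g T] sTG Tc c1; first by rewrite big_nil group1 dvdn0.
have Gg : g \in G by rewrite sTG ?mem_head.
have kg : k g = c by case/andP: Tc => /eqP.
rewrite -coset_eq1 ?prod_in_group // (prod_coset_const sTG Tc) -kg.
by rewrite coset_expg_eq1 // -coset_eq1 // kg.
Qed.

Lemma block_size T : {subset T <= G} -> block T -> (size T <= p)%N.
Proof.
case: T => // g T sTG bT; apply: zero_sum_free_size.
  by move=> h Th; rewrite sTG // inE Th orbT.
exact: zero_sum_free_behead bT.
Qed.

Lemma block_const T c : {subset T <= G} -> all (fun g => k g == c) T ->
  c != 1 -> size T = p -> block T.
Proof.
move=> sTG Tc c1 sT; split.
- by rewrite -size_eq0 sT -lt0n prime_gt0.
- by rewrite (mem_prod_const sTG Tc c1) sT.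
move=> T1 T2 T12 T1_0 T2_0.
have sT1 : {subset T1 <= T} by move=> g; rewrite -(perm_mem T12) mem_cat => ->.
rewrite (@mem_prod_const _ c) //; last 2 first.
- by move=> g /sT1 /sTG.
- by apply/allP=> g /sT1 /(allP Tc).
move: sT T1_0 T2_0; rewrite -(perm_size T12) size_cat -!size_eq0 => *.
by apply/negP=> /dvdn_leq; size_lia.
Qed.

(** The product has image [k g * c ^+ p.-1 = 1], while [c ^+ p = 1]. *)
Lemma head_coset_eq g T c : {subset g :: T <= G} -> prod (g :: T) \in N ->
  all (fun h => k h == c) T -> size T = p.-1 -> k g = c.
Proof.
move=> sTG NgT Tc sT.
have [Gg sTG'] : g \in G /\ {subset T <= G}.
  by split=> [|h Th]; rewrite sTG // inE ?eqxx ?Th ?orbT.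
case: T => [|h T] in sTG NgT Tc sT sTG' *.
  by have := prime_gt1 p_pr; simpl in sT; size_lia.
have kh : k h = c by case/andP: Tc => /eqP.
have Gc : c \in G / N by rewrite -kh mem_quotient // sTG' ?mem_head.
move: NgT; rewrite -coset_eq1 ?prod_in_group // big_cons morphM /=;
  rewrite ?nNg ?prod_in_group //= (prod_coset_const sTG' Tc) sT => /eqP kgc.
have cp := quotient_expg_p Gc; rewrite -(prednK (prime_gt0 p_pr)) expgS in cp.
by apply: (mulIg (c ^+ p.-1)); rewrite kgc cp.
Qed.

(** * Exchanges between a block and the remainder *)

Lemma count_const T b c : all (fun g => k g == c) T ->
  count (fun g => k g == b) T = (if b == c then size T else 0)%N.
Proof.
move=> Tc; case: eqP => [->|/eqP bc]; first by apply/eqP; rewrite -all_count.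
apply/eqP; rewrite -leqn0 leqNgt -has_count; apply/hasPn=> g /(allP Tc) /eqP ->.
by rewrite eq_sym.
Qed.

(** The [p] elements of [d :: V] cannot be zero-sum free, so they contain a block [Q]. It contains
    [d], since between one and [p.-1] elements of the coset [c] have no product in [N]. It needs
    another element because [k d != 1], and it cannot use all of [V] because [k d != c]. *)
Lemma absorb_element d V c :
    {subset d :: V <= G} -> all (fun g => k g == c) V -> size V = p.-1 ->
    c != 1 -> k d != 1 -> k d != c ->
  exists Q W, [/\ perm_eq (Q ++ W) (d :: V), block Q,
    all (fun g => k g == c) W & (0 < size W < p.-1)%N].
Proof.
move=> sVG Vc sV c1 kd1 kdc; have p_gt1 := prime_gt1 p_pr.
case: (block_or_zero_sum_free (d :: V))
  => [[Q [W [bQ QW]]]|/zero_sum_free_size];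
  last by move/(_ sVG); rewrite /= sV; size_lia.
have sQG : {subset Q <= G}.
  by move=> g Qg; rewrite sVG // -(perm_mem QW) mem_cat Qg.
have Qd : d \in Q.
  apply: contraT => Qd; case: bQ => Q0 NQ _.
  have Qc : all (fun g => k g == c) Q.
    apply/allP=> g Qg; have : g \in d :: V by rewrite -(perm_mem QW) mem_cat Qg.
    rewrite inE => /orP[/eqP gd|]; first by rewrite -gd Qg in Qd.
    exact: (allP Vc).
  have Wd : d \in W.
    by have := mem_head d V; rewrite -(perm_mem QW) mem_cat (negPf Qd).
  move: NQ; rewrite (mem_prod_const sQG Qc c1) => /dvdn_leq.
  have := perm_size QW; rewrite size_cat /= sV; move: Q0; rewrite -size_eq0.
  by case: (W) Wd => //= w W' _; size_lia.
have [i Q' defQ] := rot_to Qd.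
have QQ' : perm_eq (d :: Q') Q by rewrite -defQ perm_rot.
have Q'W : perm_eq (Q' ++ W) V.
  by rewrite -(perm_cons d) -cat_cons (perm_trans _ QW) // perm_cat2r.
have : all (fun g => k g == c) (Q' ++ W) by rewrite (perm_all _ Q'W).
rewrite all_cat => /andP[Q'c Wc].
exists Q, W; split=> //.
have [_ NQ' _] := block_rot i sQG bQ; rewrite defQ in NQ'.
have sQ'G : {subset d :: Q' <= G} by move=> g; rewrite (perm_mem QQ') => /sQG.
have := perm_size Q'W; rewrite size_cat sV => sQW.
have Q'0 : size Q' != 0%N.
  rewrite size_eq0; apply: contraNneq kd1 => Q'0; move: NQ'.
  by rewrite Q'0 big_seq1 -coset_eq1 // sQ'G ?mem_head.
have W0 : size W != 0%N.
  apply: contraNneq kdc => W0; apply/eqP.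
  by apply: (head_coset_eq sQ'G NQ' Q'c); rewrite -sQW W0 addn0.
by size_lia.
Qed.

(* Adding to R the blocks of R' yields a rich sequence of length less than |N|,
   so the zero-sum free remainder of R' has the maximal length p - 1, where the
   inverse theorem for G / N applies. *)
Lemma rich_complement S R R' :
    {subset S <= G} -> one_free S -> size S = (#|N| + p - 2)%N ->
    perm_eq (R ++ R') S -> rich N R (size R) ->
  exists2 c, c != 1 & (p.-1 <= count (fun g => k g == c) R')%N.
Proof.
move=> sSG fS sS RR' rR; have p_gt1 := prime_gt1 p_pr.
have [Ts [V [TsV bTs zV]]] := block_decomposition R'.
have RTV : perm_eq ((R ++ flatten Ts) ++ V) S.
  by rewrite -catA (perm_trans _ RR') // perm_cat2l.
have fRTV : one_free ((R ++ flatten Ts) ++ V).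
  by apply: one_free_perm fS; rewrite perm_sym.
have fRT := one_free_catl fRTV.
have sub U : {subset U <= (R ++ flatten Ts) ++ V} -> {subset U <= G}.
  by move=> sU g /sU; rewrite (perm_mem RTV) => /sSG.
have sVG : {subset V <= G} by apply: sub => g Vg; rewrite mem_cat Vg orbT.
have rTs : rich N (flatten Ts) (size (flatten Ts)).
  apply: rich_flatten => //; last exact: one_free_catr fRT.
  by apply: sub => g Tg; rewrite !mem_cat Tg orbT.
have lt_N := rich_lt fRT (rich_cat abN fRT rR rTs).
have sV := zero_sum_free_size sVG zV.
have szV : size V = p.-1.
  by move: sS; rewrite -(perm_size RTV) !size_cat; size_lia.
have [c Vc] := zero_sum_free_constant sVG zV szV.
exists c; last first.
  by rewrite -(seq.permP TsV) count_cat (count_const _ Vc) eqxx szV leq_addl.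
case: V => [|v V] in szV zV Vc sVG TsV RTV fRTV sub sV *.
  by rewrite /= in szV; size_lia.
have /eqP <- : k v == c by case/andP: Vc.
rewrite coset_eq1 ?sVG ?mem_head //.
by have := zV [:: v] V (perm_refl _) isT; rewrite big_seq1.
Qed.

(** Regrouping [V ++ T] into a new block and a remainder keeps the block together with [W] rich, so
    [rich_complement] puts [p.-1] elements of the remainder in one coset. Suitable regroupings rule
    out an element [d] of [T] outside the coset [c]. *)
Lemma block_same_coset S V T W c :
    {subset S <= G} -> one_free S -> size S = (#|N| + p - 2)%N ->
    perm_eq (V ++ T ++ W) S -> rich N W (size W) ->
    all (fun g => k g == c) V -> size V = p.-1 -> c != 1 ->
    block T -> all (fun g => g \notin N) T ->
  all (fun g => k g == c) T.
Proof.
move=> sSG fS sS VTW rW Vc sV c1 bT TN; have p_gt1 := prime_gt1 p_pr.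
apply: contraT => /allPn[d Td kdc].
have sub U : {subset U <= V ++ T ++ W} -> {subset U <= G}.
  by move=> sU g /sU; rewrite (perm_mem VTW) => /sSG.
have sTG : {subset T <= G} by apply: sub => g Tg; rewrite !mem_cat Tg orbT.
have sVG : {subset V <= G} by apply: sub => g Vg; rewrite !mem_cat Vg.
have rot_head g T' i : seq.rot i T = g :: T' ->
  [/\ perm_eq (g :: T') T, prod (g :: T') \in N, {subset g :: T' <= G},
      {subset T' <= G} & zero_sum_free T'].
- move=> defT; have gT'T : perm_eq (g :: T') T by rewrite -defT perm_rot.
  have := block_rot i sTG bT; rewrite defT => bT'; have [_ NT' _] := bT'.
  split=> //; first by move=> h; rewrite (perm_mem gT'T) => /sTG.
    by move=> h T'h; rewrite sTG // -(perm_mem gT'T) inE T'h orbT.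
  exact: zero_sum_free_behead bT'.
have rich_complement_block Q W' R : block Q -> {subset Q <= G} ->
    rich N W' (size W') -> perm_eq (Q ++ W' ++ R) S ->
    [/\ rich N (Q ++ W') (size (Q ++ W')) &
      exists2 b, b != 1 & (p.-1 <= count (fun g => k g == b) R)%N].
- move=> bQ sQG rW' QWR.
  have fQ : one_free (Q ++ W').
    apply: (@one_free_catl _ _ R); apply: one_free_perm fS.
    by rewrite -catA perm_sym.
  suff rQW : rich N (Q ++ W') (size (Q ++ W')).
    by split=> //; apply: (rich_complement sSG fS sS _ rQW); rewrite -catA.
  rewrite size_cat; apply: rich_cat => //.
  by apply: rich_block => //; apply: one_free_catl fQ.
have full_const T' b : {subset T' <= G} -> zero_sum_free T' ->
    (p.-1 <= count (fun g => k g == b) T')%N ->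
    all (fun g => k g == b) T' /\ size T' = p.-1.
- move=> sT'G zT' cb; have sT' := zero_sum_free_size sT'G zT'.
  have := count_size (fun g => k g == b) T'.
  by rewrite all_count => ?; split; [apply/eqP|]; size_lia.
(* If [T] meets the coset [c] in [e], then [e :: V] is a block, so the rest [T'] of [T] lies in a
   single coset. That coset is the one of [e], which puts [d] in [c]. *)
have [/hasP[e Te /eqP ke]|noc] := boolP (has (fun g => k g == c) T).
  have [i T' defT] := rot_to Te.
  have [eT'T NT' sT'G' sT'G zT'] := rot_head _ _ _ defT.
  have [||||_ [b b1]] := rich_complement_block (e :: V) W T'.
  - apply: (block_const (c := c)); rewrite /= ?ke ?eqxx ?sV //;
      last by size_lia.
    by move=> g; rewrite inE => /orP[/eqP->|/sVG] //; apply: sTG.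
  - by move=> g; rewrite inE => /orP[/eqP->|/sVG] //; apply: sTG.
  - by [].
  - rewrite (perm_trans _ VTW) //; apply/seq.permP=> a.
    move/seq.permP/(_ a): eT'T.
    by rewrite /= !count_cat /=; size_lia.
  move=> /(full_const _ _ sT'G zT')[T'b sT'].
  have kec := head_coset_eq sT'G' NT' T'b sT'.
  move: Td; rewrite -(perm_mem eT'T) inE => /orP[/eqP de|/(allP T'b)].
    by rewrite de ke eqxx in kdc.
  by rewrite -kec ke (negPf kdc).
(* Otherwise [T] misses [c]. A block formed from [d] and part of [V] leaves too few elements of the
   coset [c], so [T'] fills one coset [b], which is also that of [d]. *)
have [i T' defT] := rot_to Td.
have [dT'T NT' sT'G' sT'G zT'] := rot_head _ _ _ defT.
have Gd : d \in G by apply: sTG.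
have kd1 : k d != 1 by rewrite coset_eq1 // (allP TN).
have [||||||Q [W1 [QW1 bQ W1c sW1]]] // := @absorb_element d V c.
  by move=> g; rewrite inE => /orP[/eqP->|/sVG].
have [|||rQW [b b1]] := rich_complement_block Q W (W1 ++ T') bQ.
- move=> g Qg; have : g \in d :: V by rewrite -(perm_mem QW1) mem_cat Qg.
  by rewrite inE => /orP[/eqP->|/sVG].
- by [].
- rewrite (perm_trans _ VTW) //; apply/seq.permP=> a.
  move/seq.permP/(_ a): dT'T; move/seq.permP/(_ a): QW1.
  by rewrite /= !count_cat /=; size_lia.
rewrite count_cat (count_const _ W1c).
have noT' : count (fun g => k g == c) T' = 0%N.
  apply/eqP; rewrite -leqn0 leqNgt -has_count.
  apply: contra noc => /hasP[g T'g kg].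
  by apply/hasP; exists g; rewrite // -(perm_mem dT'T) inE T'g orbT.
case: (eqVneq b c) => [->|bc]; first by rewrite noT'; size_lia.
rewrite add0n => /(full_const _ _ sT'G zT')[T'b sT'].
have kd := head_coset_eq sT'G' NT' T'b sT'.
case: W1 => [|w W2] // in QW1 W1c sW1 *.
have /andP[/eqP kw W2c] := W1c.
have sW1G : {subset w :: W2 <= G}.
  move=> g Wg; have : g \in d :: V by rewrite -(perm_mem QW1) mem_cat Wg orbT.
  by rewrite inE => /orP[/eqP->|/sVG].
have sw : {subset w :: T' <= G}.
  by move=> g; rewrite inE => /orP[/eqP->|/sT'G] //; rewrite sW1G ?mem_head.
(* A second block, formed from [w] in the coset [c] and part of [T'], leaves the remainder [W2 ++ Z]
   with fewer than [p.-1] elements in each of [c] and [b]. *)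
have [||||||Q2 [Z [QZ bQ2 Zb sZ]]] := @absorb_element w T' b; rewrite ?kw //.
  by rewrite eq_sym.
have [|||_ [a a1]] := rich_complement_block Q2 (Q ++ W) (W2 ++ Z) bQ2.
- by move=> g Qg; rewrite sw // -(perm_mem QZ) mem_cat Qg.
- by [].
- rewrite (perm_trans _ VTW) //; apply/seq.permP=> f.
  move/seq.permP/(_ f): dT'T; move/seq.permP/(_ f): QW1.
  move/seq.permP/(_ f): QZ.
  by rewrite /= !count_cat /=; size_lia.
rewrite count_cat (count_const _ W2c) (count_const _ Zb).
case: (eqVneq a c) => [->|_]; first by rewrite eq_sym (negPf bc); size_lia.
by case: (a == b); size_lia.
Qed.

(** * Sequences of length [2p - 1] in one coset *)

Hypothesis orderN : forall z, z \in N -> z != 1 -> (p < #[z])%N.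

Lemma expg_outside g : g \in G -> g \notin N -> g ^+ p = 1.
Proof.
move=> Gg Ng; apply: (@regN g) => //; last by apply/commute_sym/commuteX.
by rewrite -coset_eq1 ?groupX // morphX ?nNg //= coset_expg_eq1.
Qed.

Lemma count_outside U g : {subset U <= G} -> one_free U -> g \notin N ->
  (count_mem g U < p)%N.
Proof.
move=> sUG fU Ng; rewrite ltnNge; apply/negP=> le_p; apply: fU.
have p_gt0 := prime_gt0 p_pr.
have Ug : g \in U by rewrite -has_pred1 has_count (leq_trans _ le_p).
have defU : perm_eq (nseq (count_mem g U) g ++ filter (predC1 g) U) U.
  have -> : nseq (count_mem g U) g = filter (pred1 g) U.
    by rewrite -size_filter; apply/esym/all_pred1P/filter_all.
  by rewrite perm_filterC.
exists (nseq p g), (nseq (count_mem g U - p) g ++ filter (predC1 g) U); split.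
- by rewrite catA -nseqD subnKC.
- by rewrite -size_eq0 size_nseq -lt0n.
by rewrite prod_nseq expg_outside // sUG.
Qed.

(** A coincidence among the products of two pairs becomes a conjugation relation, up to inversion,
    between [b1^-1 * a1] and [b2^-1 * a2]; such relations can be composed. *)
Lemma conjg_of_collision (a1 b1 a2 b2 : gT) :
    a1 * a2 = b1 * b2 \/ a1 * b2 = b1 * a2 ->
  (b1^-1 * a1) ^ b2 = b2^-1 * a2 \/ (b1^-1 * a1) ^ b2 = (b2^-1 * a2)^-1.
Proof.
case=> [e|e]; [right|left].
  have -> : a1 = b1 * b2 * a2^-1 by rewrite -e mulgK.
  by rewrite conjgE -!mulgA !mulKg invMg invgK.
have -> : a1 = b1 * a2 * b2^-1 by rewrite -e mulgK.
by rewrite conjgE -!mulgA !mulKg mulVg mulg1.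
Qed.

(* Two collisions in opposite orders make b1^-1 a1 commute with (b2 b1)^2,
   which lies outside N when p is odd. *)
Lemma no_double_collision a1 b1 a2 b2 c : odd p ->
    {subset [:: a1; b1; b2] <= G} -> k a1 = c -> k b1 = c -> k b2 = c ->
    c != 1 ->
    a1 * a2 = b1 * b2 \/ a1 * b2 = b1 * a2 ->
    a2 * a1 = b2 * b1 \/ a2 * b1 = b2 * a1 ->
  a1 = b1.
Proof.
move=> p_odd sG ka1 kb1 kb2 c1 /conjg_of_collision e1 /conjg_of_collision e2.
have [Ga1 Gb1 Gb2] : [/\ a1 \in G, b1 \in G & b2 \in G].
  by split; apply: sG; rewrite !inE eqxx ?orbT.
set e := b1^-1 * a1 in e1 e2.
have Ne : e \in N.
  by rewrite -coset_eq1 ?groupM ?groupV // morphM ?groupV ?nNg // morphV ?nNg //=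
    ka1 kb1 mulVg.
have eh : e ^ (b2 * b1) = e \/ e ^ (b2 * b1) = e^-1.
  rewrite conjgM; case: e1 => ->; rewrite ?conjVg; case: e2 => ->;
  by rewrite ?invgK; auto.
suff e1' : e = 1 by apply/esym/eqP; rewrite eq_mulVg1 -/e e1'.
apply: (@regN ((b2 * b1) ^+ 2)) => //; first by rewrite groupX ?groupM.
  rewrite -coset_eq1 ?groupX ?groupM // morphX ?morphM ?groupM ?nNg //=.
  rewrite kb1 kb2 -[c * c]/(c ^+ 2) -expgM -kb1 coset_expg_eq1 //; last first.
    by rewrite -coset_eq1 ?kb1.
  rewrite (Euclid_dvdX 2 2) // andbT dvdn_prime2 //.
  by apply: contraTneq p_odd => ->.
apply/commgP/conjg_fixP; rewrite expgS expg1 conjgM.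
by case: eh => eh; rewrite eh ?conjVg eh ?invgK.
Qed.

(** [card_mul_pairs] started from one element gives only [p] products from [p.-1] pairs. The missing
    one comes from two pairs whose product set has four elements in one of the two orders. *)
Lemma rich_same_coset_odd U c : odd p -> {subset U <= G} -> one_free U ->
    size U = (2 * p).-1 -> all (fun g => k g == c) U -> c != 1 ->
  rich N U p.+1.
Proof.
move=> p_odd sUG fU sU Uc c1; have p_gt1 := prime_gt1 p_pr.
have p_gt2 : (2 < p)%N by rewrite odd_prime_gt2.
have UN g : g \in U -> g \notin N.
  by move=> Ug; rewrite -coset_eq1 ?sUG // (eqP (allP Uc _ Ug)).
have [||ps [R [sps dps psR]]] := @distinct_pairs gT p.-1 U.
- by rewrite sU -mul2n; size_lia.
- move=> z; have [Uz|Uz] := boolP (z \in U); last by rewrite (count_memPn Uz).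
  apply: leq_trans (ltnW (count_outside sUG fU (UN z Uz))) _.
  by rewrite sU; size_lia.
have psU q : q \in ps -> q.1 \in U /\ q.2 \in U.
  move=> qps; have sq : {subset [:: q.1; q.2] <= U}.
    move=> g gq; rewrite -(perm_mem psR) mem_cat; apply/orP; left.
    by apply/flattenP; exists [:: q.1; q.2] => //; apply: (map_f _ qps).
  by split; apply: sq; rewrite !inE eqxx ?orbT.
have sR : size R = 1%N.
  have sfl : size (flatten [seq [:: q.1; q.2] | q <- ps]) = (2 * size ps)%N.
    by elim: (ps) => //= q qs ->; rewrite mulnS.
  by have := perm_size psR; rewrite size_cat sfl sps sU; size_lia.
have ops : all (fun q => p < #[q.1 * q.2^-1])%N ps.
  apply/allP=> q qps; have [Uq1 Uq2] := psU q qps; apply: orderN.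
    rewrite -coset_eq1 ?groupM ?groupV ?sUG // morphM ?groupV ?nNg ?sUG //.
    by rewrite morphV ?nNg ?sUG //= !(eqP (allP Uc _ _)) ?mulgV.
  by rewrite -eq_mulgV1 (allP dps).
(* The order [qs] of the pairs is left free, as the product sets need not commute. The one unpaired
   element, in [R], brings the length to [p], so that the products lie in [N]. *)
have richP qs : perm_eq qs ps ->
    (p.+1 <= #|(\prod_(q <- qs) [set q.1; q.2])%g|)%N -> rich N U p.+1.
- move=> qsps le_p; exists ((\prod_(q <- qs) [set q.1; q.2]) :* prod R).
  have reachP g : g \in (\prod_(q <- qs) [set q.1; q.2]) :* prod R ->
      exists T W, [/\ perm_eq (T ++ W) U, size T = p & g = prod T].
    case/rcosetP=> _ /mem_prod_pairs[T [W [TW sT ->]]] ->.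
    exists (T ++ R), W; split; last by rewrite big_cat.
      rewrite perm_catAC (perm_trans _ psR) // perm_cat2r (perm_trans TW) //.
      exact/perm_flatten/perm_map.
    by rewrite size_cat sT (perm_size qsps) sps sR addn1 prednK // prime_gt0.
  split; last first.
  - move=> g /reachP[T [W [TW sT ->]]]; exists T, W; split=> //.
    by rewrite -size_eq0 sT -lt0n prime_gt0.
  - by rewrite card_rcoset.
  apply/subsetP=> g /reachP[T [W [TW sT ->]]].
  have sTU : {subset T <= U} by move=> h Th; rewrite -(perm_mem TW) mem_cat Th.
  rewrite (@mem_prod_const _ c) ?sT //; first by move=> h /sTU /sUG.
  by apply/allP=> h /sTU /(allP Uc).
case: ps => [|[a1 b1] [|[a2 b2] ps]] in sps dps psR psU ops richP *;
  try by move: sps; rewrite /=; size_lia.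
have richP2 q1 q2 : perm_eq (q1 :: q2 :: ps) [:: (a1, b1), (a2, b2) & ps] ->
    (4 <= #|([set q1.1; q1.2] * [set q2.1; q2.2])%g|)%N -> rich N U p.+1.
- move=> q12 le4; apply: (richP _ q12); rewrite !big_cons mulgA.
  (* After the first two pairs [p - 3] pairs remain, each worth one more element. *)
  have -> : p.+1 = (4 + size ps)%N by move: sps; rewrite /=; size_lia.
  apply: (@card_mul_pairs _ p) => //.
  - by rewrite -card_gt0 (leq_trans _ le4).
  - by case/and3P: ops.
  by move: sps; rewrite /=; size_lia.
have [le4|lt4] := leqP 4 #|([set a1; b1] * [set a2; b2])%g|.
  exact: (richP2 (a1, b1) (a2, b2)).
have [le4|lt4'] := leqP 4 #|([set a2; b2] * [set a1; b1])%g|.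
  by apply: (richP2 (a2, b2) (a1, b1)) => //; rewrite (perm_catCA [:: _] [:: _]).
have [/= n1 n2] : a1 != b1 /\ a2 != b2 by case/and3P: dps.
have col (x1 y1 x2 y2 : gT) : x1 != y1 -> x2 != y2 ->
    (#|([set x1; y1] * [set x2; y2])%g| < 4)%N ->
    x1 * x2 = y1 * y2 \/ x1 * y2 = y1 * x2.
- move=> xy1 xy2; rewrite ltnNge => /negP no4.
  have [|e1] := eqVneq (x1 * x2) (y1 * y2); first by left.
  have [|e2] := eqVneq (x1 * y2) (y1 * x2); first by right.
  by case: no4; exact: card_mul_two_pairs.
have [[Ua1 Ub1] [Ua2 Ub2]] := (psU (a1, b1) (mem_head _ _),
  psU (a2, b2) (mem_behead (s := [:: _, _ & _]) (mem_head _ _))).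
(* Both orders give fewer than four products, hence a coincidence each, and [no_double_collision]
   applies. *)
suff ab1 : a1 = b1 by rewrite ab1 eqxx in n1.
apply: (@no_double_collision a1 b1 a2 b2 c) => //;
  try by apply/eqP/(allP Uc).
- by move=> g; rewrite !inE => /or3P[] /eqP->; rewrite sUG.
- exact: col.
by apply: col.
Qed.

(** The elements are involutions, so [d = u1 * u2] has inverse [u2 * u1]. With only two products
    allowed in [N], both [u1 * u3] and [u3 * u2] equal [d^-1]; multiplying them gives
    [d = d^-1 * d^-1]. *)
Lemma involution_triple u1 u2 u3 c (U := [:: u1; u2; u3]) : p = 2 ->
    {subset U <= G} -> all (fun g => k g == c) U -> c != 1 -> one_free U ->
    (forall j, rich N U j -> (j <= 2)%N) ->
  uniq U /\ exists d, [/\ d \in N, d != 1, d ^+ 3 = 1, reach U d & reach U d^-1].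
Proof.
move=> p2 sUG Uc c1 fU richU.
have [U1 U2 U3] : [/\ u1 \in U, u2 \in U & u3 \in U].
  by split; rewrite !inE eqxx ?orbT.
have sq g : g \in U -> g * g = 1.
  move=> Ug; rewrite -(expg_outside (g := g)) ?p2 ?sUG //.
  by rewrite -coset_eq1 ?sUG // (eqP (allP Uc _ Ug)).
have inv g : g \in U -> g^-1 = g.
  by move=> /sq gg; apply/eqP; rewrite eq_invg_mul gg.
have reach2 a b e : perm_eq [:: a; b; e] U -> reach U (a * b).
  by move=> abe; exists [:: a; b], [:: e]; rewrite !big_cons big_nil mulg1.
have N2 a b : a \in U -> b \in U -> a * b \in N.
  move=> Ua Ub; rewrite -coset_eq1 ?groupM ?sUG // morphM ?nNg ?sUG //=.
  rewrite (eqP (allP Uc _ Ua)) -(eqP (allP Uc _ Ub)) -morphM ?nNg ?sUG //.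
  by rewrite sq // morph1.
have r12 := reach2 u1 u2 u3 (perm_refl _).
have r21 : reach U (u2 * u1).
  by apply: (reach2 _ _ u3); apply/seq.permP=> f; size_lia.
have r13 : reach U (u1 * u3).
  by apply: (reach2 _ _ u2); apply/seq.permP=> f; size_lia.
have r32 : reach U (u3 * u2).
  by apply: (reach2 _ _ u1); apply/seq.permP=> f; size_lia.
have r23 : reach U (u2 * u3).
  by apply: (reach2 _ _ u1); apply/seq.permP=> f; size_lia.
have n1 g : reach U g -> g != 1.
  by move=> rg; apply/eqP=> g1; apply: fU; rewrite -g1.
have neq a b : a \in U -> reach U (a * b) -> b != a.
  by move=> Ua rab; apply/eqP=> ba; move: (n1 _ rab); rewrite ba sq ?eqxx.
have n12 : u2 != u1 by apply: neq r12.
have n13 : u3 != u1 by apply: neq r13.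
have n23 : u3 != u2 by apply: neq r23.
split.
  rewrite /= !inE (eq_sym u1 u2) (eq_sym u1 u3) negb_or (eq_sym u2 u3).
  by rewrite n12 n13 n23.
set d := u1 * u2 in r12.
have dV : d^-1 = u2 * u1 by rewrite invMg !inv.
have Nd : d \in N by apply: N2.
have ddV : d != d^-1.
  apply/eqP=> dd; have := orderN Nd (n1 _ r12); rewrite p2 ltnNge.
  by rewrite dvdn_leq // order_dvdn expgS expg1 {1}dd mulVg.
have only g : g \in N -> reach U g -> g != d -> g = d^-1.
  move=> Ng rg gd; apply/eqP; apply: contraT => gdV.
  suff : (3 <= 2)%N by [].
  apply: richU; exists [set g; d; d^-1]; split.
  - by rewrite !subUset !sub1set Ng Nd groupV.
  - by rewrite -setUA cardsU1 cards2 !inE negb_or gd gdV ddV.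
  by move=> h; rewrite !inE => /orP[/orP[]|] /eqP->; rewrite ?dV.
have e13 : u1 * u3 = d^-1.
  by apply: only; rewrite ?N2 // (inj_eq (mulgI u1)).
have e32 : u3 * u2 = d^-1.
  by apply: only; rewrite ?N2 // (inj_eq (mulIg u2)).
exists d; split; rewrite ?dV ?n1 //.
have dd : d = d^-1 * d^-1.
  by rewrite -{1}e13 -e32 mulgA -(mulgA u1) sq // mulg1.
by rewrite !expgS expg0 mulg1 {1}dd mulgA -(mulgA d^-1 d^-1) mulVg mulg1 mulVg.
Qed.

(** A product [g] of [T] in [N] lies outside [<[d]>], since otherwise it is [1] or [U] supplies its
    inverse. The five products are [d], [d^-1] and the coset [<[d]> :* g]. *)
Lemma rich_triple U T d :
    d \in N -> d != 1 -> d ^+ 3 = 1 -> reach U d -> reach U d^-1 ->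
    one_free (U ++ T) -> T != [::] -> rich N T (size T) ->
  rich N (U ++ T) 5.
Proof.
move=> Nd d1 d3 rd rdV fUT T0 [A [sAN sA rA]].
have od : #[d] = 3.
  apply/eqP; have : #[d] %| 3 by rewrite order_dvdn d3.
  by rewrite dvdn_divisors // !inE order_eq1 (negPf d1).
have Hd h : h \in <[d]> -> [\/ h = 1, h = d | h = d^-1].
  case/cycleP=> i ->; rewrite -(expg_mod_order d) od.
  have: (i %% 3 < 3)%N by rewrite ltn_mod.
  case: (i %% 3)%N => [|[|[|]]] // _; rewrite ?expg1;
    [by constructor 1 | by constructor 2 |].
  by constructor 3; apply/eqP; rewrite eq_sym eq_invg_mul -expgS d3.
have [g Ag] : exists g, g \in A.
  by apply/set0Pn; rewrite -card_gt0 (leq_trans _ sA) // lt0n size_eq0.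
have Ng := subsetP sAN g Ag.
have g_d : g \notin <[d]>.
  apply/negP=> /Hd[] gd; apply: fUT.
  - by rewrite -gd; apply/reach_catr/rA.
  - by rewrite -(mulVg d); apply: reach_mul => //; rewrite -gd; apply: rA.
  - by rewrite -(mulgV d); apply: reach_mul => //; rewrite -gd; apply: rA.
have sdN : <[d]> \subset N by rewrite cycle_subG.
exists (<[d]>^# :|: <[d]> :* g); split.
- rewrite subUset (subset_trans (subD1set _ _)) //.
  by apply/subsetP=> _ /rcosetP[h /(subsetP sdN) Nh ->]; rewrite groupM.
- rewrite cardsU (_ : _ :&: _ = set0) ?cards0 ?subn0.
    have := cardsD1 1 <[d]>; rewrite group1 card_rcoset -orderE od add1n.
    by case=> <-.
  apply/eqP; rewrite -subset0; apply/subsetP=> h; rewrite !inE.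
  case/andP=> /andP[_ dh]; rewrite mem_rcoset groupMl ?groupV //.
  by rewrite (negPf g_d).
move=> h; rewrite inE => /orP[/setD1P[h1 /Hd[] dh]|/rcosetP[h' /Hd[] -> ->]].
- by rewrite dh eqxx in h1.
- by rewrite dh; apply: reach_catl.
- by rewrite dh; apply: reach_catl.
- by rewrite mul1g; apply/reach_catr/rA.
- by apply: reach_mul => //; apply: rA.
by apply: reach_mul => //; apply: rA.
Qed.

(** * Structure of product-one free sequences of length [#|N| + p - 2] *)

Theorem one_free_structure S :
    {subset S <= G} -> one_free S -> size S = (#|N| + p - 2)%N ->
  (exists c V z, [/\ c != 1, size V = p.-1, all (fun g => k g == c) V, z \in N
     & perm_eq S (V ++ nseq #|N|.-1 z)])
  \/ [/\ p = 2, #|N| = 3, uniq S & all (fun g => g \notin N) S].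
Proof.
move=> sSG fS sS; have p_gt1 := prime_gt1 p_pr.
have [Ts [V [TsV bTs zV]]] := block_decomposition S.
have fTsV : one_free (flatten Ts ++ V).
  by apply: one_free_perm fS; rewrite perm_sym.
have sub W : {subset W <= flatten Ts ++ V} -> {subset W <= G}.
  by move=> sW g /sW; rewrite (perm_mem TsV) => /sSG.
have sVG : {subset V <= G} by apply: sub => g Vg; rewrite mem_cat Vg orbT.
have sTsG : {subset flatten Ts <= G} by apply: sub => g Tg; rewrite mem_cat Tg.
have rTs := rich_flatten sTsG (one_free_catl fTsV) bTs.
have [c c1 cV] := rich_complement sSG fS sS TsV rTs.
have ltVp := zero_sum_free_size sVG zV.
have sV : size V = p.-1.
  have := leq_trans cV (count_size _ _); size_lia.
have Vc : all (fun g => k g == c) V.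
  by rewrite all_count eqn_leq count_size sV.
have sTs : size (flatten Ts) = #|N|.-1.
  by move: sS; rewrite -(perm_size TsV) size_cat sV; size_lia.
have [TsN|/allPn[g /flattenP[T TTs Tg] Ng]] :=
  boolP (all (fun g => g \in N) (flatten Ts)).
  have [z def_z] := one_free_abelian_constant abN (one_free_catl fTsV)
    (fun g => allP TsN g) sTs.
  (* The default [1] is used only if [flatten Ts] is empty, and then [#|N|.-1] is [0]. *)
  left; exists c, V, (head 1 (flatten Ts)); split=> //; last first.
    rewrite perm_sym (perm_trans _ TsV) // perm_catC perm_cat2r -sTs.
    by case: (flatten Ts) def_z => //= h hs [<- hsE]; rewrite -hsE.
  by case: (flatten Ts) TsN => //= h hs /andP[].
right; have bT := bTs T TTs.
have TsT := perm_to_rem TTs; set Ts' := rem T Ts in TsT.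
have VTW : perm_eq (V ++ T ++ flatten Ts') S.
  rewrite (perm_trans _ TsV) // perm_catC perm_cat2r perm_sym.
  exact: (perm_flatten TsT).
have fVTW : one_free (V ++ T ++ flatten Ts').
  by apply: one_free_perm fS; rewrite perm_sym.
have fW := one_free_catr (one_free_catr fVTW).
have sTG : {subset T <= G}.
  by move=> h Th; rewrite sTsG //; apply/flattenP; exists T.
have bW T' : T' \in Ts' -> block T' by move=> /mem_rem /bTs.
have sWG : {subset flatten Ts' <= G}.
  by move=> h Wh; rewrite sSG // -(perm_mem VTW) !mem_cat Wh !orbT.
have rW := rich_flatten sWG fW bW.
(* By minimality a block with more than one element avoids [N], and [T] is not a single element of
   [N] because it contains [g]. *)
have TN : all (fun g => g \notin N) T.
  apply/allP=> h Th; apply/negP=> Nh; case: bT => _ _ minT.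
  have := minT [:: h] (rem h T); rewrite big_seq1 Nh => minTh.
  have hT : perm_eq ([:: h] ++ rem h T) T by rewrite perm_sym perm_to_rem.
  have := minTh hT isT; case: (rem h T) hT => [hT _|? ? _ /(_ isT)] //.
  by move: Tg; rewrite -(perm_mem hT) inE => /eqP gh; rewrite gh Nh in Ng.
have Tc := block_same_coset sSG fS sS VTW rW Vc sV c1 bT TN.
(* A block inside one nontrivial coset has size divisible by [p], and no block is longer than
   [p]. *)
have sT : size T = p.
  apply/eqP; rewrite eqn_leq block_size //=; case: bT => T0 NT _.
  by rewrite dvdn_leq ?lt0n ?size_eq0 // -(mem_prod_const sTG Tc).
pose U := V ++ T.
have fUW : one_free (U ++ flatten Ts') by rewrite -catA.
have sUG : {subset U <= G} by move=> h; rewrite mem_cat => /orP[/sVG|/sTG].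
have Uc : all (fun g => k g == c) U by rewrite all_cat Vc.
have sU : size U = (2 * p).-1 by rewrite size_cat sV sT; size_lia.
have sW : size (flatten Ts') = (#|N| - p.+1)%N.
  by move: sS; rewrite -(perm_size VTW) !size_cat sV sT; size_lia.
have leN : (p < #|N|)%N.
  by have := perm_size (perm_flatten TsT); rewrite /= sTs size_cat sT; size_lia.
(* The blocks other than [T] account for [#|N| - p.+1] products, which leaves at most [p] for
   [U]. *)
have richU j : rich N U j -> (j <= p)%N.
  move=> rU; have := rich_lt fUW (rich_cat abN fUW rU rW); rewrite sW.
  by size_lia.
have [p2|p_odd] := even_prime p_pr; last first.
  have := richU _ (rich_same_coset_odd p_odd sUG (one_free_catl fUW) sU Uc c1).
  by rewrite ltnn.
have fU := one_free_catl fUW.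
have [u1 [u2 [u3 defU]]] : exists u1 u2 u3, U = [:: u1; u2; u3].
  case: (U) sU => [|u1 [|u2 [|u3 [|]]]]; rewrite p2 // => _.
  by exists u1, u2, u3.
have := @involution_triple u1 u2 u3 c p2; rewrite -defU.
move=> /(_ sUG Uc c1 fU); rewrite {1}p2 in richU.
case=> [//|uU [d [Nd d1 d3 rd rdV]]].
case: Ts' => [|T2 Ts2] in TsT VTW fVTW fW bW sWG rW fUW sW *.
  have US : perm_eq U S by move: VTW; rewrite /= cats0.
  split; rewrite ?p2 // -?(perm_uniq US) -?(perm_all _ US) //.
    by move: leN sW; rewrite /= p2; size_lia.
  by apply/allP=> h Uh; rewrite -coset_eq1 ?sUG // (eqP (allP Uc _ Uh)).
have bT2 : block T2 by apply: bW; rewrite mem_head.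
have sT2G : {subset T2 <= G} by move=> h Th; rewrite sWG //= mem_cat Th.
have fUT2 : one_free ((U ++ T2) ++ flatten Ts2) by rewrite -catA.
have rT2 := rich_block sT2G (one_free_catl fW) bT2.
have r5 : rich N (U ++ T2) 5.
  by apply: (rich_triple Nd d1 d3 rd rdV (one_free_catl fUT2)); case: bT2.
have rTs2 : rich N (flatten Ts2) (size (flatten Ts2)).
  apply: rich_flatten (one_free_catr fW) _.
    by move=> h Th; rewrite sWG //= mem_cat Th orbT.
  by move=> T' T'Ts2; apply: bW; rewrite inE T'Ts2 orbT.
(* As [T2] has at most two elements, the blocks in [Ts2] have total size at least [#|N| - 5]; with
   five more products the total would reach [#|N|]. *)
have := rich_lt fUT2 (rich_cat abN fUT2 r5 rTs2).
move: sW (block_size sT2G bT2); rewrite /= size_cat p2 => sW leT2 lt5.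
by exfalso; size_lia.
Qed.

(** * Product-one freeness of the listed forms *)

Lemma one_free_coset_power V n c z : {subset V <= G} -> (size V < p)%N ->
    all (fun g => k g == c) V -> c != 1 -> z \in N ->
    (forall i, (0 < i <= n)%N -> z ^+ i != 1) ->
  one_free (V ++ nseq n z).
Proof.
move=> sVG ltVp Vc c1 Nz zn [T [W [TW T0 T1]]].
have VN g : g \in V -> g \notin N.
  by move=> Vg; rewrite -coset_eq1 ?sVG // (eqP (allP Vc _ Vg)).
have memT g : g \in T -> g \in V \/ g = z.
  move=> Tg; have : g \in V ++ nseq n z by rewrite -(perm_mem TW) mem_cat Tg.
  by rewrite mem_cat mem_nseq => /orP[|/andP[_ /eqP]]; auto.
have sTG : {subset T <= G} by move=> g /memT[/sVG|->] //; apply: sNG.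
have kT : k (prod T) = c ^+ count (fun g => g \notin N) T.
  elim: (T) memT sTG => [|g T' IH] memT' sTG'; first by rewrite big_nil morph1.
  have [Gg sT'G] : g \in G /\ {subset T' <= G}.
    by split=> [|h Th]; rewrite sTG' // inE ?eqxx ?Th ?orbT.
  rewrite big_cons morphM ?nNg ?prod_in_group //= IH //; last first.
    by move=> h T'h; apply: memT'; rewrite inE T'h orbT.
  have [Vg|->] := memT' g (mem_head _ _).
    by rewrite VN // expgS (eqP (allP Vc _ Vg)).
  by rewrite Nz coset_id // mul1g.
have ltTp : (count (fun g => g \notin N) T < p)%N.
  apply: leq_ltn_trans ltVp; have := seq.permP TW (fun g => g \notin N).
  rewrite !count_cat count_nseq Nz mul0n addn0 => e.
  by apply: leq_trans (count_size (fun g => g \notin N) V); rewrite -e leq_addr.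
(* The product maps to [c] raised to this count, so the count is divisible by [p]; it is also less
   than [p]. *)
have TN0 : count (fun g => g \notin N) T = 0%N.
  apply/eqP; apply: contraTT ltTp; rewrite -leqNgt -lt0n => lt0.
  have /hasP[g Tg Ng] : has (fun g => g \notin N) T by rewrite has_count.
  have [Vg|gz] := memT g Tg; last by rewrite gz Nz in Ng.
  have kg := eqP (allP Vc _ Vg).
  by rewrite dvdn_leq // -(coset_expg_eq1 _ (sVG _ Vg) Ng) kg -kT T1 morph1.
have Tz : all (pred1 z) T.
  apply/allP=> g Tg; have [/VN Ng|->] /= := memT g Tg; last exact: eqxx.
  by have : has (fun g => g \notin N) T by [apply/hasP; exists g]; 
    rewrite has_count TN0.
have leT : (size T <= n)%N.
  have := seq.permP TW (pred1 z); rewrite !count_cat count_nseq /= eqxx mul1n.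
  rewrite (count_memPn _ : count_mem z V = 0%N); last first.
    by apply/negP=> /VN; rewrite Nz.
  by move: Tz; rewrite all_count => /eqP->; rewrite add0n => <-; apply: leq_addr.
have := zn (size T); rewrite leT andbT lt0n size_eq0 => /(_ T0) /eqP; apply.
by rewrite -T1 (all_pred1P _ _ Tz) size_nseq prod_nseq.
Qed.

(** Products in [N] have even length, so a product-one subsequence would consist of two mutually
    inverse involutions, hence of two equal elements. *)
Lemma one_free_involutions S c : p = 2 -> {subset S <= G} -> uniq S ->
    size S = 3 -> all (fun g => k g == c) S -> c != 1 ->
  one_free S.
Proof.
move=> p2 sSG uS sS Sc c1 [T [W [TW T0 T1]]].
have sTS : {subset T <= S} by move=> g; rewrite -(perm_mem TW) mem_cat => ->.
have Tc : all (fun g => k g == c) T by apply/allP=> g /sTS /(allP Sc).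
have sTG : {subset T <= G} by move=> g /sTS /sSG.
have uT : uniq T by move: uS; rewrite -(perm_uniq TW) cat_uniq => /andP[].
have := mem_prod_const sTG Tc c1; rewrite T1 group1 p2 => /esym.
have : (size T <= 3)%N by rewrite -sS -(perm_size TW) size_cat leq_addr.
case: T T0 T1 sTS uT {TW Tc sTG} => [|g [|h [|? [|]]]] //= _.
rewrite !big_cons big_nil mulg1 inE andbT => gh1 sTS /eqP gh _ _; apply: gh.
have Sh : h \in S by apply: sTS; rewrite !inE eqxx orbT.
have hN : h \notin N by rewrite -coset_eq1 ?sSG // (eqP (allP Sc _ Sh)).
have := expg_outside (sSG _ Sh) hN; rewrite p2 expgS expg1 => hh.
by apply: (mulIg h); rewrite gh1 hh.
Qed.
End Frobenius.

(** * The presented group *)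

Section Presentation.
Variables (p m : nat) (r : int).
Hypotheses (p_gt1 : (1 < p)%N) (m_gt1 : (1 < m)%N).

Definition satisfies_CpCm (gT : finGroupType) (H : {set gT}) :=
  exists x y, [/\ <[x]> <*> <[y]> = H, x ^+ p = 1, y ^+ m = 1
    & y ^ x = expgz y r].

(** Turns the presentation into its universal property, in a form uniform in the sign of [r]. *)
Lemma isog_CpCmE (gT : finGroupType) (G : {group gT}) :
  isog_CpCm G p m r <->
  forall (rT : finGroupType) (H : {group rT}), H \homg G <-> satisfies_CpCm H.
Proof.
rewrite /isog_CpCm /satisfies_CpCm.
case: r => n /=; split=> isoG rT H; have := isoG rT H.
1,3: move=> ->; split=> [/existsP[[x y]] /=|[x [y [gH xp ym yx]]]];
  last by apply/existsP; exists (x, y); rewrite /= !xpair_eqE gH xp ym yx !eqxx.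
1,2: by rewrite !xpair_eqE => /and4P[/eqP ? /eqP ? /eqP ? /eqP ?]; exists x, y.
all: move=> satH; apply/idP/existsP => [/satH[x [y [gH xp ym yx]]]|[[x y]] /=];
  first by exists (x, y); rewrite /= !xpair_eqE gH xp ym yx !eqxx.
all: rewrite !xpair_eqE => /and4P[/eqP gH /eqP xp /eqP ym /eqP yx].
all: by apply/satH; exists x, y.
Qed.

Variable e : nat.
Hypothesis re : (r = e%:Z %[mod m%:Z])%Z.

Lemma expgz_mod (gT : finGroupType) (y : gT) : y ^+ m = 1 -> expgz y r = y ^+ e.
Proof.
move=> ym; move/eqP: re; rewrite eqz_mod_dvd; case: r => n /=.
  move=> dv; apply/eqP; rewrite eq_expg_mod_order; apply/eqP.
  have : (n = e %[mod m])%N.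
    by apply/eqP; rewrite -eqz_nat -!modz_nat eqz_mod_dvd.
  have oy : #[y] %| m by rewrite order_dvdn ym.
  by move=> nem; rewrite -(modn_dvdm n oy) nem modn_dvdm.
rewrite NegzE -opprD dvdzE abszN -PoszD absz_nat => /dvdnP[k nek].
have {}nek : (n.+1 + e = k * m)%N := nek.
by apply/eqP; rewrite eq_invg_mul -expgD nek mulnC expgM ym expg1n.
Qed.

Hypothesis ep : (e ^ p = 1 %[mod m])%N.

(* The lower bound comes from a model of the relations, the semidirect product
   Extremal.gtype. *)
Lemma card_CpCm (gT : finGroupType) (G : {group gT}) :
  isog_CpCm G p m r -> #|G| = (p * m)%N.
Proof.
move/isog_CpCmE=> isoG.
have cop_e : coprime m e.
  rewrite -(@coprime_pexpr p) ?(ltnW p_gt1) //.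
  by rewrite /coprime -gcdn_modr ep gcdn_modr gcdn1.
have [x [y [gG xp ym yx]]] : satisfies_CpCm G by apply/isoG/homg_refl.
apply/eqP; rewrite eqn_leq; apply/andP; split.
  have nxy : <[x]> \subset 'N(<[y]>).
    by rewrite cycle_subG inE -cycleJ cycle_subG yx expgz_mod // mem_cycle.
  rewrite -gG norm_joinEl // (@leq_trans (#[x] * #[y])) //.
    by rewrite !orderE mul_cardG leq_pmulr // cardG_gt0.
  by rewrite leq_mul // dvdn_leq ?(ltnW p_gt1) ?(ltnW m_gt1) // order_dvdn ?xp ?ym.
pose b : 'Z_m := Zp1.
have ob : #[b] = m by rewrite order_Zp1 Zp_cast.
have ue : (e%:R : 'Z_#[b])%R \in GRing.unit by rewrite unitZpE ob.
pose u := FinRing.unit _ ue.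
(* In this presentation the first generator spans the normal factor, so the roles of [x] and [y] are
   exchanged. *)
have isoM : [set: Extremal.gtype m p e] \isog
    Grp (x : y : x ^+ m, y ^+ p, x ^ y = x ^+ e).
  apply: Extremal.Grp => //; exists (Zp_unitm u).
  rewrite Aut_aut order_injm ?injm_Zp_unitm ?in_setT //; split=> //.
    rewrite order_dvdn -val_eqE /=.
    rewrite FinRing.val_unitX /= -natrX -[1%R]/(1%:R)%R.
    apply/eqP/val_inj; rewrite [LHS]val_Zp_nat ?ob // [RHS]val_Zp_nat ?ob //.
  apply/eqP; rewrite autE ?cycle_id // eq_expg_mod_order /=.
  by rewrite val_Zp_nat ?ob // modn_mod.
have : (p * m <= #|[set: Extremal.gtype m p e]|)%N by rewrite Extremal.card.
move/leq_trans; apply; apply: leq_homg; apply/isoG.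
have /existsP[[b' a']] /= := isoGrp_hom isoM.
rewrite !xpair_eqE => /and4P[/eqP gM /eqP bm /eqP ap /eqP ba].
by exists a', b'; rewrite joingC expgz_mod.
Qed.
End Presentation.

(** The residue of [r] is nonzero because its [p]-th power is [1] modulo [m]. Writing it as [e.+1]
    lets [coprime e m] express the coprimality of [r - 1] and [m] without truncated subtraction. *)
Lemma exponent_mod (p m : nat) (r : int) : prime p -> (1 < m)%N ->
    (r ^+ p = 1 %[mod m%:Z])%Z%R -> coprimez (p%:Z * (r - 1))%R m%:Z ->
  exists e, [/\ (r = e.+1%:Z %[mod m%:Z])%Z, (e.+1 ^ p = 1 %[mod m])%N,
    coprime e m & coprime p m].
Proof.
move=> p_pr m_gt1 r_pow; rewrite coprimezMl => /andP[cop_p cop_r].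
have m0 : (m%:Z != 0)%R by rewrite eqz_nat -lt0n ltnW.
pose e := `|(r %% m%:Z)%Z|%N.
have def_e : Posz e = (r %% m%:Z)%Z by rewrite gez0_abs // modz_ge0.
have re : (r = e%:Z %[mod m%:Z])%Z by rewrite def_e modz_mod.
have ep : (e ^ p = 1 %[mod m])%N.
  apply/eqP; rewrite -eqz_nat -!modz_nat; apply/eqP.
  by rewrite -r_pow -modzXm -def_e -[Posz (e ^ p)]natz natrX natz.
have e_gt0 : (0 < e)%N.
  rewrite lt0n; apply/eqP=> e0; move: ep.
  by rewrite e0 exp0n ?prime_gt0 // mod0n modn_small.
exists e.-1; rewrite prednK //; split=> //.
rewrite /coprime -/(gcdn _ _); move: cop_r; rewrite /coprimez -gcdz_modl.
rewrite (_ : (r - 1 = e.-1%:Z %[mod m%:Z])%Z).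
  by rewrite gcdz_modl.
have -> : Posz e.-1 = (Posz e - 1)%R by rewrite -subn1 -subzn.
by rewrite -modzDml re modzDml.
Qed.

(** * The subgroup generated by [y] in the presented group *)

Section Presented.
Variables (p m : nat) (r : int) (gT : finGroupType) (G : {group gT}) (x y : gT).
Variable e : nat.
Hypotheses (p_pr : prime p) (m_gt1 : (1 < m)%N).
Hypothesis re : (r = e.+1%:Z %[mod m%:Z])%Z.
Hypothesis ep : (e.+1 ^ p = 1 %[mod m])%N.
Hypotheses (cop_e : coprime e m) (cop_p : coprime p m).
Hypothesis G_pres : presented_CpCm G p m r x y.

Local Notation N := <[y]>%G.

Let oG : #|G| = (p * m)%N.
Proof.
by case: G_pres => isoG *; apply: (card_CpCm (prime_gt1 p_pr) m_gt1 re ep isoG).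
Qed.

Let yx : y ^ x = y ^+ e.+1.
Proof. by case: G_pres => _ _ _ ym ->; exact: (expgz_mod re ym). Qed.

Let nyx : <[x]> \subset 'N(<[y]>).
Proof. by rewrite cycle_subG inE -cycleJ cycle_subG yx mem_cycle. Qed.

Let defG : <[x]> * <[y]> = G.
Proof.
case: G_pres => _ <- _ _ _; rewrite -norm_joinEl //.
by rewrite joing_idl joing_idr.
Qed.

Lemma presented_gen_in : x \in G /\ y \in G.
Proof.
case: G_pres => _ <- _ _ _.
by split; apply: mem_gen; rewrite !inE eqxx ?orbT.
Qed.

(** The relations bound both orders from above, and [<[x]> * <[y]>] has [p * m] elements. *)
Lemma presented_order : #[x] = p /\ #[y] = m.
Proof.
case: G_pres => _ _ xp ym _; have [p0 m0] := (prime_gt0 p_pr, ltnW m_gt1).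
have dx : (#[x] <= p)%N by rewrite dvdn_leq // order_dvdn xp.
have dy : (#[y] <= m)%N by rewrite dvdn_leq // order_dvdn ym.
have := mul_cardG <[x]> <[y]>; rewrite defG oG -!orderE => oxy.
have le : (p * m <= #[x] * #[y])%N by rewrite oxy leq_pmulr // cardG_gt0.
split; apply/eqP; rewrite eqn_leq ?dx ?dy /=.
  rewrite -(leq_pmul2r m0) (leq_trans le) // leq_mul2l dy orbT //.
by rewrite -(leq_pmul2l p0) (leq_trans le) // leq_mul2r dx orbT.
Qed.

Lemma presented_normal : N <| G.
Proof.
rewrite /normal cycle_subG presented_gen_in.2 -defG mul_subG // normG.
Qed.

Lemma presented_quotient : #|G / N| = p.
Proof.
rewrite card_quotient ?normal_norm ?presented_normal //.
rewrite -divgS ?normal_sub ?presented_normal //.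
by rewrite oG -orderE presented_order.2 mulnK // ltnW.
Qed.

(** The centralizer of [z] contains [N] and [g], and [N] has prime index, so [z] is central.
    Commuting with [x] gives [z ^+ e = 1], while [z ^+ m = 1] and [e] is prime to [m]. *)
Lemma presented_regular g z : g \in G -> g \notin N -> z \in N ->
  commute z g -> z = 1.
Proof.
move=> Gg Ng /cycleP[i def_z] zg.
have cNz : N \subset 'C_G[z].
  rewrite subsetI normal_sub ?presented_normal //= cycle_subG.
  by apply/cent1P; rewrite def_z; apply: commuteX.
have pr_ind : prime #|G : N|.
  by rewrite -card_quotient ?presented_quotient ?normal_norm ?presented_normal.
have ltN : (#|'C_G[z] : N| != 1)%N.
  rewrite indexg_eq1; apply/negP=> /subsetP/(_ g); rewrite inE Gg (negPf Ng).
  by move=> h; case: notF; apply: h; apply/cent1P.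
have CG : #|G : 'C_G[z]| = 1%N.
  have := Lagrange_index (subsetIl G 'C[z]) cNz => eqI.
  case/primeP: pr_ind => _ /(_ #|'C_G[z] : N|); rewrite -eqI dvdn_mull //.
  move/(_ isT); rewrite (negPf ltN) /= => /eqP e1.
  have c_gt0 : (0 < #|'C_G[z] : N|)%N by apply: indexg_gt0.
  apply/eqP; rewrite -(eqn_pmul2r c_gt0) mul1n; exact/eqP/esym.
have /cent1P zx : x \in 'C[z].
  have /subsetP/(_ x) : G \subset 'C_G[z] by rewrite -indexg_eq1 CG.
  by rewrite presented_gen_in.1 => /(_ isT) /setIP[].
have ze : z ^+ e = 1.
  have : z ^ x = z by apply/conjg_fixP/commgP.
  rewrite {1}def_z conjXg yx -expgM mulnC expgM -def_z expgSr => /(canRL (mulgK _)).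
  by rewrite mulgV.
have zm : z ^+ m = 1.
  by case: G_pres => _ _ _ ym _; rewrite def_z expgAC ym expg1n.
apply/eqP; rewrite -order_eq1 -dvdn1 -(eqP (_ : gcdn e m == 1)%N) //.
by rewrite dvdn_gcd !order_dvdn ze zm eqxx.
Qed.

(** The least prime divisor of [#[z]] divides [m], hence differs from [p], and it is at least [p]
    because it divides [#|G|]. *)
Lemma presented_order_gt z : pdiv #|G| = p -> z \in N -> z != 1 ->
  (p < #[z])%N.
Proof.
move=> p_min Nz z1; have z_gt1 : (1 < #[z])%N by rewrite order_gt1.
have qm : pdiv #[z] %| m.
  by rewrite (dvdn_trans (pdiv_dvd _)) // -presented_order.2 orderE order_dvdG.
apply: leq_trans (pdiv_leq (order_gt0 z)).
rewrite ltn_neqAle; apply/andP; split.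
  apply: contraTneq cop_p => ->; rewrite prime_coprime ?pdiv_prime //.
  by rewrite qm.
rewrite -p_min pdiv_min_dvd ?prime_gt1 ?pdiv_prime // oG.
by rewrite dvdn_mull.
Qed.

Lemma presented_mem g : g \in G -> exists i, exists2 j : 'I_m,
  (i < p)%N & g = x ^+ i * y ^+ j.
Proof.
have [ox oy] := presented_order; rewrite -defG.
case/mulsgP=> _ _ /cyclePmin[i lti ->] /cyclePmin[j ltj ->] ->.
by rewrite ox in lti; rewrite oy in ltj; exists i, (Ordinal ltj).
Qed.

Lemma presented_mem_coset a g : g \in G -> coset N g = coset N (x ^+ a) ->
  exists j : 'I_m, g = x ^+ a * y ^+ j.
Proof.
move=> Gg kg; have [Gx _] := presented_gen_in; have [_ oy] := presented_order.
have nN h : h \in G -> h \in 'N(N) by apply/subsetP/normal_norm/presented_normal.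
have /cyclePmin[j ltj def_j] : (x ^+ a)^-1 * g \in <[y]>.
  apply: coset_idr; first by rewrite nN ?groupM ?groupV ?groupX.
  by rewrite morphM ?morphV ?nN ?groupV ?groupX //= kg mulVg.
by rewrite oy in ltj; exists (Ordinal ltj); rewrite /= -def_j mulKVg.
Qed.

End Presented.

Lemma isog_CpCm_congr (p m e : nat) (r : int) (gT : finGroupType)
    (G : {group gT}) : (r = e%:Z %[mod m%:Z])%Z ->
  isog_CpCm G p m r <-> isog_CpCm G p m e%:Z.
Proof.
move=> re; rewrite !isog_CpCmE; split=> isoG rT H; rewrite isoG;
  by split=> -[x [y [gH xp ym yx]]]; exists x, y; split=> //;
  rewrite yx (expgz_mod re ym).
Qed.

(** * From cosets of [N] to explicit forms and back *)

Section Translation.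
Variables (p m : nat) (r : int) (gT : finGroupType) (G : {group gT}) (x y : gT).
Variable e : nat.
Implicit Types (S : seq gT).
Hypotheses (p_pr : prime p) (m_gt1 : (1 < m)%N).
Hypothesis re : (r = e.+1%:Z %[mod m%:Z])%Z.
Hypothesis ep : (e.+1 ^ p = 1 %[mod m])%N.
Hypotheses (cop_e : coprime e m) (cop_p : coprime p m).
Hypothesis G_pres : presented_CpCm G p m r x y.
Hypothesis p_min : pdiv #|G| = p.

Local Notation N := <[y]>%G.

Let Gxy := presented_gen_in G_pres.
Let oxy := presented_order p_pr m_gt1 re ep G_pres.
Let nNG := presented_normal re G_pres.
Let oGN := presented_quotient p_pr m_gt1 re ep G_pres.
Let abN : abelian N := cycle_abelian y.
Let regN := presented_regular p_pr m_gt1 re ep cop_e G_pres.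
Let orderN z (Nz : z \in N) := presented_order_gt p_pr m_gt1 re ep cop_p G_pres p_min Nz.

Let nN g : g \in G -> g \in 'N(N).
Proof. by apply/subsetP/normal_norm/nNG. Qed.

Let xN : x \notin N.
Proof.
apply/negP=> /order_dvdG; rewrite -orderE oxy.1 oxy.2 => pm.
by move: cop_p; rewrite prime_coprime // pm.
Qed.

Let coset_xy a j : coset N (x ^+ a * y ^+ j) = coset N (x ^+ a).
Proof.
have [Gx Gy] := Gxy.
by rewrite morphM ?nN ?groupX //= (coset_id (mem_cycle y j)) mulg1.
Qed.

Let coset_xa a : (1 <= a <= p.-1)%N -> coset N (x ^+ a) != 1.
Proof.
case/andP=> a_gt0 a_lt; have [Gx _] := Gxy.
rewrite morphX ?nN //= (coset_expg_eq1 p_pr nNG oGN) //.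
by apply/negP=> /dvdn_leq; have := prime_gt0 p_pr; size_lia.
Qed.

(** Form (i), kept for all [p] and [m]: when [p = 2] and [m = 3] it is the second alternative of
    form (ii). *)
Definition coset_power_form S := exists (a : nat) (b : (p.-1).-tuple 'I_m) (c : nat),
  [/\ (1 <= a <= p.-1)%N, (1 <= c <= m.-1)%N, coprime c m
    & perm_eq S ([seq x ^+ a * y ^+ val bi | bi <- b] ++ nseq m.-1 (y ^+ c))].

Lemma coset_power_form_one_free S : coset_power_form S -> one_free S.
Proof.
case=> a [b [c [a_bd c_bd cop_c SV]]]; have [Gx Gy] := Gxy.
rewrite perm_sym in SV; apply: one_free_perm SV _.
apply: (one_free_coset_power p_pr nNG oGN (c := coset N (x ^+ a))).
- by move=> _ /mapP[j _ ->]; rewrite groupM ?groupX.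
- by rewrite size_map size_tuple prednK ?prime_gt0.
- by apply/allP=> _ /mapP[j _ ->]; rewrite coset_xy.
- exact: coset_xa.
- exact: mem_cycle.
move=> i /andP[i_gt0 i_lt]; rewrite -expgM -order_dvdn oxy.2.
rewrite Gauss_dvdr; last by rewrite coprime_sym.
by apply/negP=> /dvdn_leq; size_lia.
Qed.

Lemma reflections_one_free S : p = 2 -> m = 3 ->
  perm_eq S [:: x; x * y; x * y ^+ 2] -> one_free S.
Proof.
move=> p2 m3 SV; have [Gx Gy] := Gxy; rewrite perm_sym in SV.
apply: one_free_perm SV _; have oy := oxy.2; rewrite m3 in oy.
have defV : [:: x; x * y; x * y ^+ 2] = [seq x ^+ 1 * y ^+ j | j <- [:: 0; 1; 2]%N].
  by rewrite /= !expg1 expg0 mulg1.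
rewrite defV.
apply: (one_free_involutions p_pr nNG oGN regN (c := coset N (x ^+ 1))) => //.
- by move=> _ /mapP[j _ ->]; rewrite groupM ?groupX.
- rewrite map_inj_in_uniq // => i j; rewrite !inE => i3 j3 /mulgI /eqP.
  rewrite eq_expg_mod_order oy.
  by case/or3P: i3 => /eqP->; case/or3P: j3 => /eqP->.
- by apply/allP=> _ /mapP[j _ ->]; rewrite coset_xy.
by apply: coset_xa; rewrite p2.
Qed.

Lemma one_free_forms S :
    {subset S <= G} -> size S = (m + p - 2)%N -> one_free S ->
  coset_power_form S \/
  [/\ p = 2, m = 3 & perm_eq S [:: x; x * y; x * y ^+ 2]].
Proof.
move=> S_G S_size fS; have [ox oy] := oxy; have [Gx Gy] := Gxy; have oN : #|N| = m by [].
have sS : size S = (#|N| + p - 2)%N by rewrite oN.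
have p_gt1 := prime_gt1 p_pr.
case: (one_free_structure p_pr abN nNG oGN regN orderN S_G fS sS); last first.
  rewrite oN => -[p2 m3 uS SN]; right; split=> //.
  (* These are the only elements outside [N] when [p = 2] and [m = 3], so three distinct ones
     exhaust them. *)
  have sub : {subset S <= [:: x; x * y; x * y ^+ 2]}.
    move=> g Sg.
    have [i [j lti def_g]] := presented_mem p_pr m_gt1 re ep G_pres (S_G g Sg).
    case: i lti def_g => [|[|i]] lti def_g; last by rewrite p2 in lti.
      by move: (allP SN g Sg); rewrite def_g mul1g mem_cycle.
    rewrite def_g expg1; move: (nat_of_ord j) (ltn_ord j) => n; rewrite m3.
    by case: n => [|[|[|]]] // _; rewrite !inE ?expg0 ?mulg1 ?expg1 eqxx ?orbT.
  have leS : (2 < size S)%N by rewrite S_size m3 p2.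
  apply: uniq_perm (leq_size_uniq uS sub leS) _ => //.
  exact: (uniq_min_size uS sub leS).2.
case=> c0 [V [z [c01 sV Vc Nz SV]]]; left.
have sVG : {subset V <= G}.
  by move=> g Vg; rewrite S_G // (perm_mem SV) mem_cat Vg.
have [v Vv] : exists v, v \in V.
  by case: (V) sV => [/= |v ? _]; [size_lia | exists v; rewrite mem_head].
have [a [j lta def_v]] := presented_mem p_pr m_gt1 re ep G_pres (sVG v Vv).
have def_c0 : c0 = coset N (x ^+ a).
  by rewrite -(eqP (allP Vc v Vv)) def_v coset_xy.
have [b def_V] : exists b : seq 'I_m, V = [seq x ^+ a * y ^+ val bi | bi <- b].
  elim: (V) sVG Vc => [|g V' IH] sV'G /=; first by exists [::].
  case/andP=> /eqP kg /IH[|b ->]; first by move=> h V'h; rewrite sV'G // inE V'h orbT.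
  have [j' ->] := presented_mem_coset p_pr m_gt1 re ep G_pres
    (sV'G g (mem_head _ _)) (etrans kg def_c0).
  by exists (j' :: b).
have sb : size b == p.-1 by rewrite -sV def_V size_map.
have /cyclePmin[c ltc def_z] := Nz; rewrite oy in ltc.
(* A common divisor [d > 1] would make the product of [m %/ d] copies of [z] equal to [1], and
   [m.-1] copies are available. *)
have cop_c : coprime c m.
  have m_gt0 := ltnW m_gt1; set d := gcdn c m.
  have d_gt0 : (0 < d)%N by rewrite gcdn_gt0 m_gt0 orbT.
  rewrite /coprime -/d eqn_leq d_gt0 andbT leqNgt; apply/negP=> d_gt1.
  have [dc dm] : d %| c /\ d %| m by rewrite dvdn_gcdl dvdn_gcdr.
  have i_gt0 : (0 < m %/ d)%N by rewrite divn_gt0 // dvdn_leq.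
  have i_lt : (m %/ d < m)%N by rewrite ltn_Pdiv.
  apply: (@one_free_catr _ V (nseq #|N|.-1 z)); first exact: one_free_perm SV fS.
  exists (nseq (m %/ d) z), (nseq (m.-1 - m %/ d) z); split.
  - by rewrite -nseqD subnKC ?oN //; size_lia.
  - by rewrite -size_eq0 size_nseq -lt0n.
  rewrite prod_nseq; apply/eqP; rewrite def_z -expgM -order_dvdn oy.
  by rewrite muln_divCA // dvdn_mulr.
have c_gt0 : (0 < c)%N.
  rewrite lt0n; apply: contraTneq cop_c => ->.
  by rewrite /coprime gcd0n neq_ltn m_gt1 orbT.
have a_gt0 : (0 < a)%N.
  by rewrite lt0n; apply: contraNneq c01 => a0; rewrite def_c0 a0 expg0 morph1.
exists a, (Tuple sb), c; split=> //; try by size_lia.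
by rewrite (perm_trans SV) // oN def_V def_z.
Qed.

(** The order [6 = p * m], with [p] its least prime divisor, determines [p] and [m]; conversely
    these values determine [r] modulo [m]. *)
Lemma isog_C2C3 : isog_CpCm G 2 3 2%:Z <-> p = 2 /\ m = 3.
Proof.
have oG : #|G| = (p * m)%N.
  by case: G_pres => isoG *; apply: (card_CpCm (prime_gt1 p_pr) m_gt1 re ep isoG).
split=> [/(@card_CpCm 2 3 2%:Z isT isT 2 erefl erefl) oG6 | [p2 m3]].
  have p2 : p = 2 by rewrite -p_min oG6.
  by split=> //; move: oG; rewrite oG6 p2; size_lia.
case: G_pres => isoG *; rewrite p2 m3 in isoG.
(* Modulo [3], [e] is not [0] by coprimality and not [2] because [e.+1 ^ 2] is [1], so [e.+1] is
   [2]. *)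
have r2 : (r = 2%:Z %[mod 3%:Z])%Z.
  have := re; rewrite m3 => ->; apply/eqP; rewrite !modz_nat eqz_nat; apply/eqP.
  move: cop_e ep; rewrite p2 m3 -[e.+1]addn1 -modnXm -modnDml /coprime -gcdn_modl.
  have : (e %% 3 < 3)%N by rewrite ltn_mod.
  by case: (e %% 3)%N => [|[|[|]]].
exact/(isog_CpCm_congr 2 G r2).
Qed.

End Translation.

Theorem theorem1p1 (p m : nat) (r : int) (gT : finGroupType) (G : {group gT})
    (x y : gT) (S : seq gT)
    (p_prime : prime p)
    (m_gt1 : (1 < m)%N)
    (r_pow : (r ^+ p = 1 %[mod m%:Z])%Z%R)
    (r_coprime : coprimez (p%:Z * (r - 1))%R m%:Z)
    (G_pres : presented_CpCm G p m r x y)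
    (p_min : pdiv #|G| = p)
    (S_G : {subset S <= G})
    (S_size : size S = (m + p - 2)%N) :
  product_one_free S
  <->
  ((~ isog_CpCm G 2 3 2%:Z ->
      exists (a : nat) (b : (p.-1).-tuple 'I_m) (c : nat),
        [/\ (1 <= a <= p.-1)%N,
            (1 <= c <= m.-1)%N,
            coprime c m
          & perm_eq S ([seq x ^+ a * y ^+ val bi | bi <- b]
                         ++ nseq m.-1 (y ^+ c))%g])
   /\
   (isog_CpCm G 2 3 2%:Z ->
      perm_eq S [:: x; x * y; x * y ^+ 2]%g
      \/
      exists b c : nat,
        [/\ (0 <= b <= 2)%N,
            (1 <= c <= 2)%N
          & perm_eq S [:: x * y ^+ b; y ^+ c; y ^+ c]%g])).
Proof.
have [e [re ep cop_e cop_p]] := exponent_mod p_prime m_gt1 r_pow r_coprime.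
have isogE := isog_C2C3 p_prime m_gt1 re ep cop_e G_pres p_min.
have freeE : product_one_free S <-> one_free S.
  by split=> fS /Pi_allE.
have formF := coset_power_form_one_free p_prime m_gt1 re ep cop_p G_pres.
have reflF := reflections_one_free p_prime m_gt1 re ep cop_e cop_p G_pres.
have Fform := one_free_forms p_prime m_gt1 re ep cop_e cop_p G_pres p_min S_G S_size.
rewrite freeE isogE; split=> [fS | [notC2C3 C2C3]]; last first.
  have [p2m3 | np2m3] := boolP ((p == 2) && (m == 3)); last first.
    apply/formF/notC2C3 => -[p2 m3]; by rewrite p2 m3 in np2m3.
  have [/eqP p2 /eqP m3] := andP p2m3; have [SV|[b [c [b_bd c_bd SV]]]] := C2C3 (conj p2 m3).
    exact: reflF SV.
  (* For [p = 2] the exponent of [x] is [1] and the tuple has one entry; [c] is prime to [3] because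
     it is [1] or [2]. *)
  clear p_min; subst p m; apply: formF; exists 1%N, [tuple inord b], c.
  split=> //; first by case: c c_bd {SV} => [|[|[]]].
  by rewrite /= inordK ?expg1.
split=> [nC2C3 | [p2 m3]]; have [form|[p2' m3' SV]] := Fform fS; auto.
  by case: nC2C3.
clear p_min; subst p m; right.
case: form => a [[[|b0 [|? ?]] //= sb] [c [a_bd c_bd _ SV]]].
exists b0, c; split=> //; first exact: (ltn_ord b0).
have a1 : a = 1%N by case: a a_bd {SV} => [|[]].
by rewrite a1 expg1 in SV.
Qed.
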